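(* The coinvariant space $\overline{\mathcal{T}_{1,1}}$ is a cyclic $\mathfrak{A}$-module, generated by the image of the Gaussian $\psi_{1,1}$.
   Context: $V=V_{1,1}=\mathbb{C}^2$ with hermitian form $(u,u')=\bar u_1u'_1-\bar u_2u'_2$. $\mathfrak{t}=\mathfrak{t}_{1,1}=\mathfrak{su}(V)\oplus V$, a real vector space of dimension $7$ with elements $(x,u)$, on which $U(V)$ acts by $g\cdot(x,u)=(gxg^{-1},gu)$. $\mathbb{C}[\mathfrak{t}]$ and $\mathbb{C}\{\mathfrak{t}\}$ denote complex-valued polynomial functions on the real vector space $\mathfrak{t}$ and the Weyl algebra of polynomial differential operators. The Siegel Gaussian is $\psi_{1,1}(x,u)=\exp(-2\pi[\sum_{j,k}|x_{jk}|^2+2|u_1|^2+2|u_2|^2])$, and $\mathcal{T}_{1,1}=\mathbb{C}[\mathfrak{t}]\psi_{1,1}$. $U(V)(\mathbb{R})$ acts on functions by $(g\cdot\Psi)(X)=\Psi(g^{-1}X)$; differentiation gives an action of $\mathfrak{u}(V)$ on $\mathcal{T}_{1,1}$, and $\overline{\mathcal{T}_{1,1}}$ is the quotient of $\mathcal{T}_{1,1}$ by the span of all $L(\Psi)$, $L\in\mathfrak{u}(V)$, $\Psi\in\mathcal{T}_{1,1}$. For a real quadratic space $(W,Q)$ of dimension $N$ with coordinates such that $Q=\frac12(\sum_{j\le a}x_j^2-\sum_{j>a}x_j^2)$, the infinitesimal Weil representation $\omega:\mathfrak{sl}_2(\mathbb{C})\to\mathbb{C}\{W\}$ is $\omega\begin{pmatrix}1&\\&-1\end{pmatrix}=\frac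 N2+\sum x_j\partial_{x_j}$, $\omega\begin{pmatrix}0&1\\0&0\end{pmatrix}=2\pi iQ$, $\omega\begin{pmatrix}0&0\\1&0\end{pmatrix}=\frac i{4\pi}(\sum_{j\le a}\partial_{x_j}^2-\sum_{j>a}\partial_{x_j}^2)$. Applied to $\mathfrak{su}(V)$ with $Q_0=-\mathrm{tr}(x^2)$ and to $V$ (as a real vector space) with $Q_1=2(u,u)$, it gives $\omega:\mathfrak{sl}_2\times\mathfrak{sl}_2\to\mathbb{C}\{\mathfrak{t}\}^{U(V)}$. $\mathfrak{A}\subset\mathbb{C}\{\mathfrak{t}\}^{U(V)}$ is the $\mathbb{C}$-subalgebra generated by the image of $\omega$ and the ring of invariant polynomials $\mathbb{C}[\mathfrak{t}]^{U(V)}=\mathbb{C}[-\det x,(u,u),(u,xu)/i]$. It acts on $\mathcal{T}_{1,1}$ by differentiation and the action descends to $\overline{\mathcal{T}_{1,1}}$. *)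

(* Defs.v *)
From HB Require Import structures.
From mathcomp Require Import all_boot all_order all_algebra.
From mathcomp Require Import complex.
From mathcomp Require Import all_classical all_reals all_analysis.
Import Order.TTheory GRing.Theory Num.Theory.
Import numFieldNormedType.Exports.
From mathcomp Require Import ring lra.

Set Implicit Arguments.
Unset Strict Implicit.
Unset Printing Implicit Defensive.

Local Open Scope classical_set_scope.
Local Open Scope ring_scope.

Section Generic.
Variables (F : pzRingType) (E : lmodType F).

Definition lspan (S : set E) : set E :=
  [set v | exists n (c : 'I_n -> F) (w : 'I_n -> E),
    (forall i, S (w i)) /\ v = \sum_i c i *: w i].

(* The unital subalgebra, for composition, generated by a set of operators. *)
Inductive gen_algebra (S : set (E -> E)) : set (E -> E) :=
| gen_in D of S D : gen_algebra S D
| gen_id : gen_algebra S id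
| gen_add D D' of gen_algebra S D & gen_algebra S D' :
    gen_algebra S (fun f => D f + D' f)
| gen_scale c D of gen_algebra S D : gen_algebra S (fun f => c *: D f)
| gen_comp D D' of gen_algebra S D & gen_algebra S D' :
    gen_algebra S (D \o D').

Definition quot_class (T K : set E) (f : E) : set E :=
  [set g | T g /\ K (g - f)].

Definition quot (T K : set E) : set (set E) := [set quot_class T K f | f in T].

(* The operators in A induce linear endomorphisms of T / K. *)
Definition acts_on_quot (A : set (E -> E)) (T K : set E) : Prop :=
  K `<=` T /\
  forall D, A D ->
    [/\ forall f, T f -> T (D f),
        forall a f g, T f -> T g -> D (a *: f + g) = a *: D f + D g
      & forall f, K f -> K (D f)].

Definition cyclic_quot (A : set (E -> E)) (T K : set E) (f0 : E) : Prop :=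
  [/\ acts_on_quot A T K, T f0
    & forall c, quot T K c -> exists2 D, A D & c = quot_class T K (D f0)].

End Generic.

Section HermitianPlane.
Variable R : realType.
Local Notation C := R[i].
(* Num.Theory's Re and Im on numClosedFieldType take values in C, not in R. *)
Local Notation cRe := (@complex.Re R).
Local Notation cIm := (@complex.Im R).

Definition hform (u v : 'cV[C]_2) : C :=
  (u 0 0)^*%C * v 0 0 - (u 1 0)^*%C * v 1 0.

Definition uV (x : 'M[C]_2) : Prop :=
  forall u v, hform (x *m u) v + hform u (x *m v) = 0.

Definition suV (x : 'M[C]_2) : Prop := uV x /\ \tr x = 0.

Definition is_unitary (g : 'M[C]_2) : Prop :=
  g \in unitmx /\ forall u v, hform (g *m u) (g *m v) = hform u v.

Lemma hformDl u u' v : hform (u + u') v = hform u v + hform u' v.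
Proof. by rewrite /hform !mxE !rmorphD /=; ring. Qed.

Lemma hformDr u v v' : hform u (v + v') = hform u v + hform u v'.
Proof. by rewrite /hform !mxE; ring. Qed.

Lemma hformNl u v : hform (- u) v = - hform u v.
Proof. by rewrite /hform !mxE !rmorphN /=; ring. Qed.

Lemma hformNr u v : hform u (- v) = - hform u v.
Proof. by rewrite /hform !mxE; ring. Qed.

Lemma hformZl c u v : hform (c *: u) v = (c^*)%C * hform u v.
Proof. by rewrite /hform !mxE !rmorphM /=; ring. Qed.

Lemma hformZr c u v : hform u (c *: v) = c * hform u v.
Proof. by rewrite /hform !mxE; ring. Qed.

Definition tpred : {pred 'M[C]_2 * 'cV[C]_2} := fun X => `[< suV X.1 >].

Record tsp : Type := Tsp { tval :> 'M[C]_2 * 'cV[C]_2 ; _ : tpred tval }.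

HB.instance Definition _ := [isSub for tval].
HB.instance Definition _ := [Choice of tsp by <:].

Fact tpred_zmod_closed : zmod_closed tpred.
Proof.
split=> [|X Y /asboolP[hX tX] /asboolP[hY tY]]; apply/asboolP; split=> /=.
- by move=> u v; rewrite !mul0mx /hform !mxE !rmorph0; ring.
- by rewrite mxtrace0.
- move=> u v; rewrite !mulmxBl hformDl hformDr hformNl hformNr addrACA hX add0r.
  by rewrite -opprD hY oppr0.
- by rewrite linearB /= tX tY subr0.
Qed.
HB.instance Definition _ := GRing.isZmodClosed.Build _ tpred tpred_zmod_closed.
HB.instance Definition _ := [SubChoice_isSubZmodule of tsp by <:].

Fact tpredP (X : tsp) : suV (tval X).1.
Proof. by case: X => X hX; apply/asboolP. Qed.

Fact tscale_subproof (r : R) (X : tsp) :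
  tpred (r%:C%C *: (tval X).1, r%:C%C *: (tval X).2).
Proof.
have [hX tX] := tpredP X; apply/asboolP; split=> /= [u v|].
  rewrite -!scalemxAl hformZl hformZr (_ : (r%:C^*)%C = r%:C%C).
    by rewrite -mulrDr hX mulr0.
  by rewrite /real_complex_def /= oppr0.
by rewrite linearZ /= tX mulr0.
Qed.
Definition tscale r X : tsp := Tsp (tscale_subproof r X).

Fact tscaleA a b v : tscale a (tscale b v) = tscale (a * b) v.
Proof. by apply/val_inj; rewrite /= !scalerA rmorphM. Qed.
Fact tscale1 : left_id 1 tscale.
Proof. by move=> v; apply/val_inj; rewrite /= !rmorph1 !scale1r; case: (val v). Qed.
Fact tscaleDr : right_distributive tscale +%R.
Proof. by move=> a u v; apply/val_inj; rewrite /= !scalerDr. Qed.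
Fact tscaleDl v : {morph tscale^~ v : a b / a + b}.
Proof. by move=> a b; apply/val_inj; rewrite /= !rmorphD !scalerDl. Qed.
HB.instance Definition _ :=
  GRing.Zmodule_isLmodule.Build R tsp tscaleA tscale1 tscaleDr tscaleDl.

Definition xpart (X : tsp) : 'M[C]_2 := (tval X).1.
Definition upart (X : tsp) : 'cV[C]_2 := (tval X).2.

Record UV : Type := MkUV { gval :> 'M[C]_2 ; gvalP : is_unitary gval }.

Fact UVinv_subproof (g : UV) : is_unitary (invmx g).
Proof.
case: g => g [/= ug hg]; split=> [|u v]; first by rewrite unitmx_inv.
by rewrite -hg !mulKVmx.
Qed.
Definition UVinv (g : UV) : UV := MkUV (UVinv_subproof g).

Fact tact_subproof (g : UV) (X : tsp) :
  tpred (g *m xpart X *m invmx g, g *m upart X).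
Proof.
have [_ hi] := UVinv_subproof g.
case: g hi => g [/= ug hg] hi; have [hX tX] := tpredP X.
apply/asboolP; split=> /= [u v|]; last by rewrite mxtrace_mulC mulKmx.
by rewrite /xpart /= -hi -[X in _ + X]hi -!mulmxA !mulKmx.
Qed.
Definition tact (g : UV) (X : tsp) : tsp := Tsp (tact_subproof g X).

Local Notation fct := (tsp -> C).

Definition fun_act (g : UV) (Psi : fct) : fct := fun X => Psi (tact (UVinv g) X).

Definition cderive (h : R -> C) (s : R) : C :=
  (derive1 (fun r => cRe (h r)) s +i* derive1 (fun r => cIm (h r)) s)%C.

Definition is_cderive (h : R -> C) (s : R) (z : C) : Prop :=
  is_derive s 1 (fun r => cRe (h r)) (cRe z) /\
  is_derive s 1 (fun r => cIm (h r)) (cIm z).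

(* A total operation on functions, but a derivative only where the directional
   derivative exists. Differential operators are represented by maps from
   functions to functions, used only on smooth functions (elements of T11). *)
Definition dird (v : tsp) (f : fct) : fct :=
  fun X => cderive (fun s => f (X + s *: v)) 0.

Inductive polyfun : set fct :=
| poly_cst c : polyfun (fun=> c)
| poly_lin (l : {scalar tsp}) : polyfun (fun X => (l X)%:C%C)
| poly_add P P' of polyfun P & polyfun P' : polyfun (fun X => P X + P' X)
| poly_mul P P' of polyfun P & polyfun P' : polyfun (fun X => P X * P' X).

Definition inv_polyfun : set fct :=
  [set P | polyfun P /\ forall g, fun_act g P = P].

Definition abs2 (z : C) : R := cRe z ^+ 2 + cIm z ^+ 2.

Definition psi11 : fct := fun X =>
  (expR (- (2 * pi * (\sum_j \sum_k abs2 (xpart X j k)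
                      + 2 * abs2 (upart X 0 0) + 2 * abs2 (upart X 1 0)))))%:C%C.

Definition T11 : set fct :=
  [set Psi | exists2 P, polyfun P & Psi = fun X => P X * psi11 X].

(* The one-parameter subgroup s |-> exp (s L) of U(V). *)
Definition one_param (gam : R -> UV) (L : 'M[C]_2) : Prop :=
  [/\ gval (gam 0) = 1%:M,
      forall s t, gval (gam (s + t)) = gam s *m gam t
    & forall j k, is_cderive (fun s => gval (gam s) j k) 0 (L j k)].

(* Phi = L(Psi), for L in u(V). *)
Definition lie_act (L : 'M[C]_2) (Psi Phi : fct) : Prop :=
  exists2 gam, one_param gam L
    & Phi = fun X => cderive (fun s => fun_act (gam s) Psi X) 0.

Definition coinv_rel : set fct :=
  lspan [set Phi | exists L Psi, [/\ uV L, T11 Psi & lie_act L Psi Phi]].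

Definition Q0 : fct := fun X => - \tr (xpart X *m xpart X).
Definition Q1 : fct := fun X => 2 * hform (upart X) (upart X).

(* The infinitesimal Weil representation attached to a quadratic form Q on a
   subspace of tsp of dimension N with basis b and coordinates x in which
   Q = 1/2 (sum_(j < a) x_j ^ 2 - sum_(j >= a) x_j ^ 2). *)
Definition weil (N a : nat) (Q : fct) (b : 'I_N -> tsp) (x : 'I_N -> tsp -> R)
    (M : 'M[C]_2) (f : fct) : fct :=
  M 0 0 *: ((N%:R / 2) *: f
            + \sum_j (fun X => (x j X)%:C%C * dird (b j) f X))
  + M 0 1 *: (fun X => 2 * pi%:C%C * 'i%C * Q X * f X)
  + M 1 0 *: (('i%C / (4 * pi%:C%C)) *:
               (\sum_(j < N | (j < a)%N) dird (b j) (dird (b j) f)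
                - \sum_(j < N | (a <= j)%N) dird (b j) (dird (b j) f))).

Definition mx2 (a b c d : C) : 'M[C]_2 := \matrix_(j, k)
  if j == 0 then (if k == 0 then a else b) else (if k == 0 then c else d).

Definition col2 (a b : C) : 'cV[C]_2 := \col_j if j == 0 then a else b.

(* The elements of tsp with coordinates c on su(V) and d on V; in terms of
   these, Q0 and Q1 have the normal form required by weil, see Q0E and Q1E. *)
Definition tcoord_val (c : 'rV[R]_3) (d : 'rV[R]_4) : 'M[C]_2 * 'cV[C]_2 :=
  (mx2 (0 +i* (c 0 0 / 2)) ((c 0 1 / 2) +i* (c 0 2%:R / 2))
       ((c 0 1 / 2) -i* (c 0 2%:R / 2)) (0 -i* (c 0 0 / 2)),
   col2 ((d 0 0 / 2) +i* (d 0 1 / 2)) ((d 0 2%:R / 2) +i* (d 0 3%:R / 2)))%C.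

Fact tcoord_subproof c d : tpred (tcoord_val c d).
Proof.
apply/asboolP; split=> [u v|] /=; last first.
  rewrite /mxtrace !big_ord_recl big_ord0 !mxE /=.
  by apply/eqP; rewrite eq_complex /=; apply/andP; split; apply/eqP; ring.
rewrite /hform !mxE !big_ord_recl !big_ord0 !mxE /=.
rewrite (_ : lift ord0 ord0 = 1); last exact/val_inj.
case: (u 0 0) (u 1 0) (v 0 0) (v 1 0) => [u1 u2] [u3 u4] [v1 v2] [v3 v4].
by apply/eqP; rewrite eq_complex /=; apply/andP; split; apply/eqP; ring.
Qed.
Definition tcoord c d : tsp := Tsp (tcoord_subproof c d).

Definition su_basis (j : 'I_3) : tsp := tcoord (delta_mx 0 j) 0.
Definition V_basis (j : 'I_4) : tsp := tcoord 0 (delta_mx 0 j).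

Definition su_coord (j : 'I_3) (X : tsp) : R :=
  [:: 2 * cIm (xpart X 0 0); 2 * cRe (xpart X 0 1);
      2 * cIm (xpart X 0 1)]`_j.
Definition V_coord (j : 'I_4) (X : tsp) : R :=
  [:: 2 * cRe (upart X 0 0); 2 * cIm (upart X 0 0);
      2 * cRe (upart X 1 0); 2 * cIm (upart X 1 0)]`_j.

Lemma su_coordK c d j : su_coord j (tcoord c d) = c 0 j.
Proof.
case: j => [[|[|[|//]]] hj]; rewrite /su_coord /xpart /= !mxE /=;
  rewrite mulrC divfK ?pnatr_eq0//; congr (c 0 _); exact/val_inj.
Qed.

Lemma V_coordK c d j : V_coord j (tcoord c d) = d 0 j.
Proof.
case: j => [[|[|[|[|//]]]] hj]; rewrite /V_coord /upart /= !mxE /=;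
  rewrite mulrC divfK ?pnatr_eq0//; congr (d 0 _); exact/val_inj.
Qed.

Let I2P (j : 'I_2) : j = 0 \/ j = 1.
Proof. by case: j => [[|[|//]] hj]; [left | right]; exact/val_inj. Qed.

Lemma suV_entries (X : tsp) : [/\ xpart X 1 1 = - xpart X 0 0,
  cRe (xpart X 0 0) = 0 & xpart X 1 0 = ((xpart X 0 1)^*)%C].
Proof.
rewrite /xpart; have [hX tX] := tpredP X; set x := (val X).1 in hX tX *.
have h11 : x 1 1 = - x 0 0.
  apply/eqP; rewrite -addr_eq0 addrC -[X in _ == X]tX /mxtrace.
  by rewrite !big_ord_recl big_ord0 addr0; apply/eqP; congr (_ + x _ _); exact/val_inj.
have e2 : lift ord0 ord0 = 1 :> 'I_2 by exact/val_inj.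
have := hX (col2 1 0) (col2 1 0); have := hX (col2 1 0) (col2 0 1).
rewrite /hform !mxE !big_ord_recl !big_ord0 !mxE /= !e2.
case: (x 0 0) h11 => a b ->; case: (x 0 1) => c d; case: (x 1 0) => e f.
move=> [] h1 h2 [] h3 h4; split=> //=; first lra.
by congr (_ +i* _)%C; lra.
Qed.

Lemma tcoordE X : X = tcoord (\row_j su_coord j X) (\row_j V_coord j X).
Proof.
have [h11 h00 h10] := suV_entries X; apply/val_inj.
have half (a : R) : 2 * a / 2 = a by rewrite mulrC mulKf ?pnatr_eq0.
rewrite /= /tcoord_val !mxE /su_coord /V_coord /= !half.
rewrite [LHS]surjective_pairing; congr (_, _).
  apply/matrixP => j k; rewrite mxE -/(xpart X).
  have [->|->] := I2P j; have [->|->] := I2P k; rewrite /= ?h11 ?h10.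
  - by case: (xpart X 0 0) h00 => a b /= ->.
  - by case: (xpart X 0 1).
  - by case: (xpart X 0 1).
  - by case: (xpart X 0 0) h00 => a b /= ->; rewrite -[LHS]/(- 0 -i* b)%C oppr0.
apply/matrixP => j k; rewrite mxE (ord1 k) -/(upart X).
have [->|->] := I2P j => /=.
- by case: (upart X 0 0).
- by case: (upart X 1 0).
Qed.

Lemma tcoord_linear a c c' d d' :
  tcoord (a *: c + c') (a *: d + d') = a *: tcoord c d + tcoord c' d'.
Proof.
apply/val_inj; congr (_, _); apply/matrixP => j k; rewrite !mxE;
  case: ifP => _; rewrite -?fun_if; try case: ifP => _;
  by apply/eqP; rewrite eq_complex /=; apply/andP; split; apply/eqP; field.
Qed.

Lemma tcoord_sum c d :
  tcoord c d = \sum_j c 0 j *: su_basis j + \sum_j d 0 j *: V_basis j.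
Proof.
have t00 : tcoord 0 0 = 0.
  by have := tcoord_linear (-1) 0 0 0 0; rewrite !scaler0 !addr0 scaleN1r addNr.
have tD c1 c2 d1 d2 : tcoord (c1 + c2) (d1 + d2) = tcoord c1 d1 + tcoord c2 d2.
  by have := tcoord_linear 1 c1 c2 d1 d2; rewrite !scale1r.
have tZ a c1 d1 : tcoord (a *: c1) (a *: d1) = a *: tcoord c1 d1.
  by have := tcoord_linear a c1 0 d1 0; rewrite !addr0 t00 addr0.
rewrite -[in LHS](addr0 c) -[in LHS](add0r d) tD; congr (_ + _).
- rewrite [in LHS](row_sum_delta c) (big_morph (fun v => tcoord v 0) (id1 := 0)
    (op1 := +%R)) //; last by move=> v w; rewrite -tD addr0.
  by apply: eq_bigr => j _; rewrite /su_basis -tZ scaler0.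
- rewrite [in LHS](row_sum_delta d) (big_morph (fun v => tcoord 0 v) (id1 := 0)
    (op1 := +%R)) //; last by move=> v w; rewrite -tD addr0.
  by apply: eq_bigr => j _; rewrite /V_basis -tZ scaler0.
Qed.

Lemma Q0E X : Q0 X =
  ((su_coord 0 X ^+ 2 - su_coord 1 X ^+ 2 - su_coord 2%:R X ^+ 2) / 2)%:C%C.
Proof.
have [h11 h00 h10] := suV_entries X.
rewrite /Q0 /su_coord /mxtrace /= !big_ord_recl big_ord0 !mxE.
rewrite !big_ord_recl !big_ord0 (_ : lift ord0 ord0 = 1); last exact/val_inj.
rewrite h11 h10; case: (xpart X 0 0) h00 => a b /= ->.
case: (xpart X 0 1) => c d.
by apply/eqP; rewrite eq_complex /=; apply/andP; split; apply/eqP; field.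
Qed.

Lemma Q1E X : Q1 X = ((V_coord 0 X ^+ 2 + V_coord 1 X ^+ 2
                       - V_coord 2%:R X ^+ 2 - V_coord 3%:R X ^+ 2) / 2)%:C%C.
Proof.
rewrite /Q1 /V_coord /hform /=.
case: (upart X 0 0) (upart X 1 0) => [a b] [c d].
by apply/eqP; rewrite eq_complex /=; apply/andP; split; apply/eqP; field.
Qed.

Definition weil_su : 'M[C]_2 -> fct -> fct := weil 1 Q0 su_basis su_coord.
Definition weil_V : 'M[C]_2 -> fct -> fct := weil 2 Q1 V_basis V_coord.

Definition omega (M M' : 'M[C]_2) (f : fct) : fct := weil_su M f + weil_V M' f.

Definition frakA : set (fct -> fct) :=
  gen_algebra [set D |
    (exists M M', [/\ \tr M = 0, \tr M' = 0 & D = omega M M']) \/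
    (exists2 P, inv_polyfun P & D = fun f X => P X * f X)].

End HermitianPlane.

(* Main.v *)
(* In the coordinates crd the Gaussian is exp(-pi sum_k crd_k^2), so that a
   linear vector field sends P psi to P' psi plus a quadratic multiple of P psi.
   Filter T11 by the degree of P and show by induction on the degree that P psi
   lies, modulo coinvariants, in the module generated by psi.  In the complex
   coordinates a (real), w on su(V) and u, v on V, up to lower degree:
   - the diagonal elements of the two copies of sl_2, together with Q0 and Q1,
     multiply P by a^2, |w|^2, |u|^2 and |v|^2;
   - the compact part of u(V) kills every monomial of nonzero weight;
   - the noncompact part gives the relations u^* v = 2 i a w^* and
     u v^* = - 2 i a w in the quotient.
   These reduce every monomial to 1 or a.  Finally a psi is obtained from the
   cubic invariant (u, x u) / i: applied to psi it is a sum of eigenvectors of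
   the compact elements of the two copies of sl_2, and projecting to the right
   eigenvalue leaves a psi. *)
Require Import Defs.
From HB Require Import structures.
From mathcomp Require Import all_boot all_order all_algebra.
From mathcomp Require Import complex.
From mathcomp Require Import all_classical all_reals all_analysis.
Import Order.TTheory GRing.Theory Num.Theory.
Import numFieldNormedType.Exports.
From mathcomp Require Import ring lra zify.

Set Implicit Arguments.
Unset Strict Implicit.
Unset Printing Implicit Defensive.

Local Open Scope classical_set_scope.
Local Open Scope ring_scope.

(** * Derivatives of complex-valued functions of a real variable *)

Section CDerive.
Variable R : realType.
Local Notation C := R[i].
Local Notation cRe := (@complex.Re R).
Local Notation cIm := (@complex.Im R).
Implicit Types (h k : R -> C) (s : R) (z w : C).

(** [dird] is a total operation, so identities between derivatives hold only where the derivatives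
    exist. The inductive class [smooth] marks such functions: it contains [T11] and is stable under
    [dird], and everything is proved by induction on it, with coordinates along curves in place of a
    topology on [tsp]. In [lie_act] the one-parameter subgroup is existentially quantified.
    Stability of the coinvariant relations receives it as a datum; the spanning argument has to
    produce it, and does so for the diagonal L and the off-diagonal L with |b| = 1, whose
    exponentials are explicit. A monomial of weight zero without a conjugate pair is a power of [za]
    times a power of [zwb * zu * zvb] or of its conjugate. The noncompact relation does not lower
    its degree; it trades [zu * zvb] for [za * zw], and the new [zw] forms a pair with [zwb], which
    the diagonal elements then remove. The Weil operators respect parity under x -> -x, and the
    Gaussian is even, so from it they produce only even functions. The odd function [za * psi]
    therefore has to start from the cubic invariant, the odd one among the generating invariants. *)

Lemma is_derive_cast (f : R -> R) s d d' :
  is_derive s 1 f d -> d = d' -> is_derive s 1 f d'.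
Proof. by move=> + <-. Qed.

Lemma is_derive_bigsum (I : Type) (r : seq I) (F : I -> R -> R) (d : I -> R) s :
  (forall i, is_derive s 1 (F i) (d i)) ->
  is_derive s 1 (fun t => \sum_(i <- r) F i t) (\sum_(i <- r) d i).
Proof.
move=> hF; elim: r => [|i r IH].
  rewrite big_nil (_ : (fun t => _) = cst 0); first exact: is_derive_cst.
  by apply/funext => t; rewrite big_nil.
rewrite big_cons (_ : (fun t => _) = F i + (fun t => \sum_(i <- r) F i t)).
  exact: is_deriveD.
by apply/funext => t; rewrite big_cons.
Qed.

Lemma is_cderive_eq h s z z' : is_cderive h s z -> z = z' -> is_cderive h s z'.
Proof. by move=> + <-. Qed.

Lemma cderiveE h s z : is_cderive h s z -> cderive h s = z.
Proof.
by case: z => a b [/= h1 h2]; rewrite /cderive !derive1E !derive_val.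
Qed.

Lemma is_cderive_cst z s : is_cderive (fun=> z) s 0.
Proof. by split; exact: is_derive_cst. Qed.

Lemma is_cderive_real (f : R -> R) s d :
  is_derive s 1 f d -> is_cderive (fun r => (f r)%:C%C) s d%:C%C.
Proof. by move=> hf; split=> //=; exact: is_derive_cst. Qed.

Lemma is_cderive_complex (f g : R -> R) s d e :
  is_derive s 1 f d -> is_derive s 1 g e ->
  is_cderive (fun r => (f r +i* g r)%C) s (d +i* e)%C.
Proof. by []. Qed.

Lemma is_cderiveD h k s z w : is_cderive h s z -> is_cderive k s w ->
  is_cderive (fun r => h r + k r) s (z + w).
Proof.
move=> [h1 h2] [k1 k2]; split.
  rewrite (_ : (fun r => _) = (cRe \o h) + (cRe \o k)); last first.
    by apply/funext => r; rewrite fctE /=; case: (h r) (k r) => ? ? [].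
  by apply: (is_derive_cast (is_deriveD h1 k1)); case: z w {h1 h2 k1 k2} => ? ? [].
rewrite (_ : (fun r => _) = (cIm \o h) + (cIm \o k)); last first.
  by apply/funext => r; rewrite fctE /=; case: (h r) (k r) => ? ? [].
by apply: (is_derive_cast (is_deriveD h2 k2)); case: z w {h1 h2 k1 k2} => ? ? [].
Qed.

Lemma is_cderiveM h k s z w : is_cderive h s z -> is_cderive k s w ->
  is_cderive (fun r => h r * k r) s (z * k s + h s * w).
Proof.
move=> [h1 h2] [k1 k2]; split.
  rewrite (_ : (fun r => _) =
      (cRe \o h) * (cRe \o k) - (cIm \o h) * (cIm \o k)); last first.
    by apply/funext => r; rewrite !fctE /=; case: (h r) (k r) => ? ? [].
  apply: (is_derive_cast (is_deriveB (is_deriveM h1 k1) (is_deriveM h2 k2))) => /=.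
  case: z w (h s) (k s) {h1 h2 k1 k2} => ? ? [? ?] [? ?] [? ?] /=.
  by rewrite /GRing.scale /=; ring.
rewrite (_ : (fun r => _) =
    (cRe \o h) * (cIm \o k) + (cIm \o h) * (cRe \o k)); last first.
  by apply/funext => r; rewrite !fctE /=; case: (h r) (k r) => ? ? [].
apply: (is_derive_cast (is_deriveD (is_deriveM h1 k2) (is_deriveM h2 k1))) => /=.
  case: z w (h s) (k s) {h1 h2 k1 k2} => ? ? [? ?] [? ?] [? ?] /=.
by rewrite /GRing.scale /=; ring.
Qed.

End CDerive.

(** * Derivations of T11 *)

Section Coordinates.
Variable R : realType.
Local Notation C := R[i].
Local Notation cRe := (@complex.Re R).
Local Notation cIm := (@complex.Im R).
Local Notation tsp := (tsp R).
Local Notation fct := (tsp -> C).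
Local Notation idx := ('I_3 + 'I_4)%type.
Implicit Types (X v w : tsp) (f g : fct) (k : idx).

Definition crd k : tsp -> R :=
  match k with inl j => su_coord j | inr j => V_coord j end.
Definition bas k : tsp :=
  match k with inl j => su_basis R j | inr j => V_basis R j end.

Lemma xpartD X Y : xpart (X + Y) = xpart X + xpart Y. Proof. by []. Qed.
Lemma upartD X Y : upart (X + Y) = upart X + upart Y. Proof. by []. Qed.
Lemma xpartZ (a : R) X : xpart (a *: X) = a%:C%C *: xpart X. Proof. by []. Qed.
Lemma upartZ (a : R) X : upart (a *: X) = a%:C%C *: upart X. Proof. by []. Qed.

Lemma complexReD (z w : C) : cRe (z + w) = cRe z + cRe w.
Proof. by case: z w => ? ? []. Qed.
Lemma complexImD (z w : C) : cIm (z + w) = cIm z + cIm w.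
Proof. by case: z w => ? ? []. Qed.
Lemma complexReZ (a : R) (z : C) : cRe (a%:C%C * z) = a * cRe z.
Proof. by case: z => ? ? /=; rewrite mul0r subr0. Qed.
Lemma complexImZ (a : R) (z : C) : cIm (a%:C%C * z) = a * cIm z.
Proof. by case: z => ? ? /=; rewrite mul0r addr0. Qed.

Fact crd_is_scalar k : scalar (crd k).
Proof.
move=> a X Y; case: k => [[[|[|[|//]]] ?]|[[|[|[|[|//]]]] ?]] /=;
rewrite /su_coord /V_coord /= ?xpartD ?xpartZ ?upartD ?upartZ !mxE
  ?complexReD ?complexImD ?complexReZ ?complexImZ;
by rewrite mulrDr mulrCA.
Qed.
HB.instance Definition _ k := GRing.isLinear.Build R tsp R _ (crd k) (crd_is_scalar k).

Lemma crd_bas j k : crd j (bas k) = (j == k)%:R.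
Proof.
case: j k => [j|j] [k|k] /=; rewrite /su_basis /V_basis ?su_coordK ?V_coordK ?mxE //.
Qed.

Lemma sum_crd X : X = \sum_k crd k X *: bas k.
Proof.
rewrite {1}(tcoordE X) tcoord_sum big_sumType /=.
by congr (_ + _); apply: eq_bigr => j _; rewrite mxE.
Qed.

Lemma scalar_sum (l : {scalar tsp}) X : l X = \sum_k l (bas k) * crd k X.
Proof.
rewrite {1}(sum_crd X) linear_sum; apply: eq_bigr => k _.
by rewrite linearZ /= mulrC.
Qed.

(** Straight lines (for [dird]) and orbits of one-parameter subgroups (for [lie_act]) are both such
    curves, which lets the two kinds of derivative be compared. *)
Definition velocity (c : R -> tsp) v :=
  forall k, is_derive (0 : R) 1 (fun s => crd k (c s)) (crd k v).

Lemma is_derive_line (l : {scalar tsp}) X v :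
  is_derive (0 : R) 1 (fun s => l (X + s *: v)) (l v).
Proof.
rewrite (_ : (fun s => _) = cst (l X) + id * cst (l v)).
  apply: (is_derive_cast (is_deriveD (is_derive_cst _ _ _)
    (is_deriveM (is_derive_id _ _) (is_derive_cst _ _ _)))).
  by rewrite /GRing.scale/= !(mul0r, mulr1, mulr0, add0r).
by apply/funext => s; rewrite linearD linearZ !fctE.
Qed.

Lemma velocity_line X v : velocity (fun s => X + s *: v) v.
Proof. by move=> k; exact: (is_derive_line (crd k)). Qed.

(** Coordinates are twice the entries. Each independent real parameter of x occurs in two entries
    and each |u_j|^2 carries a factor 2, so 2 pi * 2 * (crd / 2)^2 = pi * crd^2 throughout. *)
Lemma psi11E X : psi11 X = (expR (- pi * \sum_k crd k X ^+ 2))%:C%C.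
Proof.
rewrite /psi11; congr (expR _)%:C%C; rewrite mulNr; congr (- _).
have [h11 h00 h10] := suV_entries X.
rewrite big_sumType /= !big_ord_recl !big_ord0 /= /su_coord /V_coord /=.
rewrite (_ : lift ord0 ord0 = 1); last exact/val_inj.
rewrite /abs2 h11 h10; case: (xpart X 0 0) h00 => a b /= ->.
by case: (xpart X 0 1) (upart X 0 0) (upart X 1 0) => ? ? [? ?] [? ?] /=; ring.
Qed.

Lemma is_cderive_psi c v : velocity c v ->
  is_cderive (fun s => psi11 (c s)) 0
    ((- (2 * pi) * \sum_k crd k v * crd k (c 0))%:C%C * psi11 (c 0)).
Proof.
move=> hv; rewrite (_ : (fun s => _) =
    fun s => ((expR \o (- pi \*: (fun s => \sum_k crd k (c s) ^+ 2))) s)%:C%C); last first.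
  by apply/funext => s; rewrite psi11E.
apply: is_cderive_eq.
  refine (is_cderive_real (is_derive1_comp (is_derive_expR _) (is_deriveZ _ _))).
  apply: (@is_derive_bigsum R _ _ _ (fun k => 2 * crd k (c 0) * crd k v)) => k.
  rewrite (_ : (fun t => _) = (fun s => crd k (c s)) * (fun s => crd k (c s))).
    apply: (is_derive_cast (is_deriveM (hv k) (hv k))).
    by rewrite /GRing.scale /=; ring.
  by apply/funext.
rewrite /= psi11E /GRing.scale /= -rmorphM mulrC.
by rewrite /=; congr (_ * _)%:C%C; rewrite !mulr_sumr; apply: eq_bigr => k _; ring.
Qed.

(** A syntactic substitute for smoothness: the algebra generated by coordinates and the Gaussian. It
    is large enough for all functions that occur and stable under [dird], so second derivatives make
    sense. *)
Inductive smooth : set fct :=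
| smooth_cst z : smooth (fun=> z)
| smooth_crd k : smooth (fun X => (crd k X)%:C%C)
| smooth_psi : smooth (@psi11 R)
| smoothD f g of smooth f & smooth g : smooth (fun X => f X + g X)
| smoothM f g of smooth f & smooth g : smooth (fun X => f X * g X).

Lemma smooth_sum (I : Type) (r : seq I) (F : I -> fct) :
  (forall i, smooth (F i)) -> smooth (fun X => \sum_(i <- r) F i X).
Proof.
move=> hF; elim: r => [|i r IH].
  by rewrite (_ : (fun X => _) = fun=> 0); [exact: smooth_cst|apply/funext => X; rewrite big_nil].
rewrite (_ : (fun X => _) = fun X => F i X + \sum_(i <- r) F i X); first exact: smoothD.
by apply/funext => X; rewrite big_cons.
Qed.

Lemma smooth_scalar (l : {scalar tsp}) : smooth (fun X => (l X)%:C%C).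
Proof.
rewrite (_ : (fun X => _) = fun X => \sum_k (l (bas k))%:C%C * (crd k X)%:C%C).
  apply: smooth_sum => k; apply: smoothM; [exact: smooth_cst|exact: smooth_crd].
apply/funext => X; rewrite scalar_sum rmorph_sum.
by apply: eq_bigr => k _; rewrite rmorphM.
Qed.

Lemma smooth_poly f : polyfun f -> smooth f.
Proof.
elim=> [z|l|P Q _ hP _ hQ|P Q _ hP _ hQ].
- exact: smooth_cst.
- exact: smooth_scalar.
- exact: smoothD.
- exact: smoothM.
Qed.

(** The gradient is chosen before the curve, so the derivative depends only, and linearly, on the
    velocity; its entries are again [smooth], so the construction can be iterated. *)
Lemma smooth_grad f : smooth f -> exists2 df : idx -> fct, forall k, smooth (df k) &
  forall c v, velocity c v ->
    is_cderive (fun s => f (c s)) 0 (\sum_k (crd k v)%:C%C * df k (c 0)).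
Proof.
elim=> [z|j||{}f g sf [df sdf hdf] sg [dg sdg hdg]|{}f g sf [df sdf hdf] sg [dg sdg hdg]].
- exists (fun _ _ => 0) => [_|c v _]; first exact: smooth_cst.
  by rewrite big1 => [|k _]; [exact: is_cderive_cst|rewrite mulr0].
- exists (fun k _ => (j == k)%:R) => [k|c v hv]; first exact: smooth_cst.
  apply: (is_cderive_eq (is_cderive_real (hv j))).
  rewrite (bigD1 j) //= eqxx mulr1 big1 ?addr0 // => k.
  by rewrite eq_sym => /negPf ->; rewrite mulr0.
- exists (fun k X => (- (2 * pi))%:C%C * (crd k X)%:C%C * psi11 X) => [k|c v hv].
    apply: smoothM; last exact: smooth_psi.
    by apply: smoothM; [exact: smooth_cst|exact: smooth_crd].
  apply: (is_cderive_eq (is_cderive_psi hv)); rewrite rmorphM rmorph_sum mulr_sumr mulr_suml.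
  by apply: eq_bigr => k _; rewrite rmorphM; ring.
- exists (fun k X => df k X + dg k X) => [k|c v hv]; first exact: smoothD.
  apply: (is_cderive_eq (is_cderiveD (hdf _ _ hv) (hdg _ _ hv))).
  by rewrite -big_split; apply: eq_bigr => k _; rewrite mulrDr.
- exists (fun k X => df k X * g X + f X * dg k X) => [k|c v hv].
    by apply: smoothD; apply: smoothM.
  apply: (is_cderive_eq (is_cderiveM (hdf _ _ hv) (hdg _ _ hv))).
  rewrite mulr_suml mulr_sumr -big_split; apply: eq_bigr => k _.
  by rewrite /=; ring.
Qed.

Lemma smooth_dirdE f : smooth f -> exists2 df : idx -> fct, forall k, smooth (df k) &
  forall v, dird v f = fun X => \sum_k (crd k v)%:C%C * df k X.
Proof.
move=> /smooth_grad[df sdf hdf]; exists df => // v; apply/funext => X.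
by rewrite /dird (cderiveE (hdf _ _ (velocity_line X v))) scale0r addr0.
Qed.

Lemma smooth_curve f c v : smooth f -> velocity c v ->
  is_cderive (fun s => f (c s)) 0 (dird v f (c 0)).
Proof.
move=> /smooth_grad[df sdf hdf] hv; apply: (is_cderive_eq (hdf _ _ hv)).
by rewrite /dird (cderiveE (hdf _ _ (velocity_line (c 0) v))) scale0r addr0.
Qed.

Lemma smooth_dird f v : smooth f -> smooth (dird v f).
Proof.
move=> /smooth_dirdE[df sdf ->]; apply: smooth_sum => k.
by apply: smoothM => //; exact: smooth_cst.
Qed.

Lemma dird_sum f v X : smooth f ->
  dird v f X = \sum_k (crd k v)%:C%C * dird (bas k) f X.
Proof.
move=> /smooth_dirdE[df _ e]; rewrite e; apply: eq_bigr => k _; congr (_ * _).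
rewrite e (bigD1 k) //= crd_bas eqxx mul1r big1 ?addr0 // => j jk.
by rewrite crd_bas (negPf jk) mul0r.
Qed.

Lemma dird_cst z v : dird v (fun=> z) = fun=> 0.
Proof. by apply/funext => X; exact: cderiveE (is_cderive_cst _ _). Qed.

Lemma dird_scalar (l : {scalar tsp}) v :
  dird v (fun X => (l X)%:C%C) = fun=> (l v)%:C%C.
Proof.
apply/funext => X; apply: cderiveE; apply: is_cderive_real.
exact: is_derive_line.
Qed.

Lemma dird_line f v X : smooth f -> is_cderive (fun s : R => f (X + s *: v)) 0 (dird v f X).
Proof.
move=> sf; have := smooth_curve sf (velocity_line X v).
by rewrite scale0r addr0.
Qed.

Lemma dirdD f g v : smooth f -> smooth g ->
  dird v (fun X => f X + g X) = fun X => dird v f X + dird v g X.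
Proof.
move=> sf sg; apply/funext => X; apply: cderiveE.
exact: is_cderiveD (dird_line v X sf) (dird_line v X sg).
Qed.

Lemma dirdM f g v : smooth f -> smooth g ->
  dird v (fun X => f X * g X) = fun X => dird v f X * g X + f X * dird v g X.
Proof.
move=> sf sg; apply/funext => X; apply: cderiveE.
apply: (is_cderive_eq (is_cderiveM (dird_line v X sf) (dird_line v X sg))).
by rewrite scale0r addr0.
Qed.

Lemma dirdZ z f v : smooth f -> dird v (z *: f) = z *: dird v f.
Proof.
move=> sf; rewrite (_ : z *: f = fun X => (fun=> z) X * f X) // dirdM //.
  by apply/funext => X; rewrite dird_cst mul0r add0r.
exact: smooth_cst.
Qed.

Lemma dird_psi v :
  dird v (@psi11 R) = fun X => (- (2 * pi) * \sum_k crd k v * crd k X)%:C%C * psi11 X.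
Proof.
apply/funext => X; apply: (cderiveE (is_cderive_eq (is_cderive_psi (velocity_line X v)) _)).
by rewrite scale0r addr0.
Qed.

Lemma dirdC f v w : smooth f -> dird v (dird w f) = dird w (dird v f).
Proof.
move=> sf; elim: sf v w => [z|k||{}f g sf IHf sg IHg|{}f g sf IHf sg IHg] v w.
- by rewrite !dird_cst.
- by rewrite !(dird_scalar (crd k)) !dird_cst.
(* The explicit second derivative of the Gaussian is visibly symmetric in the two directions: a
   symmetric bilinear form plus a product of two linear forms. *)
- have H v1 w1 : dird v1 (dird w1 (@psi11 R)) = fun X =>
     ((- (2 * pi)) * (\sum_k crd k w1 * crd k v1))%:C%C * psi11 X +
     (- (2 * pi) * \sum_k crd k w1 * crd k X)%:C%C *
     ((- (2 * pi) * \sum_k crd k v1 * crd k X)%:C%C * psi11 X).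
    rewrite dird_psi; set l := fun X : tsp => - (2 * pi) * \sum_k crd k w1 * crd k X.
    have hl : scalar l.
      move=> a X Y; rewrite /l !mulr_sumr -big_split; apply: eq_bigr => k _ /=.
      by rewrite (crd_is_scalar k a X Y); ring.
    pose l' := GRing.isLinear.Build R tsp R _ l hl.
    pose L : {scalar tsp} := HB.pack l l'.
    rewrite (dirdM (f := fun X => (l X)%:C%C)); [|exact: (smooth_scalar L)|exact: smooth_psi].
    by rewrite dird_psi (dird_scalar L).
  rewrite !H; apply/funext => X; congr (_ + _); last by ring.
  by congr ((_ * _)%:C%C * _); apply: eq_bigr => k _; rewrite mulrC.
- have sd u := smooth_dird u sf; have se u := smooth_dird u sg.
  rewrite (dirdD w sf sg) (dirdD v sf sg) (dirdD v (sd w) (se w)) (dirdD w (sd v) (se v)).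
  by rewrite IHf IHg.
- have sd u := smooth_dird u sf; have se u := smooth_dird u sg.
  rewrite (dirdM w sf sg) (dirdM v sf sg).
  rewrite (dirdD v (smoothM (sd w) sg) (smoothM sf (se w))).
  rewrite (dirdD w (smoothM (sd v) sg) (smoothM sf (se v))).
  rewrite (dirdM v (sd w) sg) (dirdM v sf (se w)) (dirdM w (sd v) sg) (dirdM w sf (se v)).
  apply/funext => X; rewrite IHf IHg.
  move: (dird w (dird v f) X) (dird w (dird v g) X) (dird v f X) (dird w f X) (dird v g X)
    (dird w g X) (f X) (g X) => *; ring.
Qed.

Lemma dird_linear f v w (a : R) X : smooth f ->
  dird (a *: v + w) f X = a%:C%C * dird v f X + dird w f X.
Proof.
move=> /smooth_dirdE[df _ e]; rewrite !e mulr_sumr -big_split; apply: eq_bigr => k _ /=.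
by rewrite (crd_is_scalar k a v w) rmorphD rmorphM /=; ring.
Qed.

(** A linear A gives a linear vector field: the infinitesimal action of u(V) when A is [xi], the
    Euler field of a summand when A is a projection. *)
Definition vfield (A : tsp -> tsp) f : fct := fun X => dird (A X) f X.

Lemma vfieldE A f : smooth f ->
  vfield A f = fun X => \sum_k (crd k (A X))%:C%C * dird (bas k) f X.
Proof. by move=> sf; apply/funext => X; exact: dird_sum. Qed.

Lemma smooth_vfield (A : {linear tsp -> tsp}) f : smooth f -> smooth (vfield A f).
Proof.
move=> sf; rewrite vfieldE //; apply: smooth_sum => k; apply: smoothM; last exact: smooth_dird.
exact: (smooth_scalar (crd k \o A)).
Qed.

Lemma vfieldD A f g : smooth f -> smooth g ->
  vfield A (fun X => f X + g X) = fun X => vfield A f X + vfield A g X.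
Proof. by move=> sf sg; apply/funext => X; rewrite /vfield dirdD. Qed.

Lemma vfieldM A f g : smooth f -> smooth g ->
  vfield A (fun X => f X * g X) = fun X => vfield A f X * g X + f X * vfield A g X.
Proof. by move=> sf sg; apply/funext => X; rewrite /vfield dirdM. Qed.

Lemma vfieldZ A z f : smooth f -> vfield A (z *: f) = z *: vfield A f.
Proof. by move=> sf; apply/funext => X; rewrite /vfield dirdZ. Qed.

Lemma vfield_cst A z : vfield A (fun=> z) = fun=> 0.
Proof. by apply/funext => X; rewrite /vfield dird_cst. Qed.

Lemma vfield_psi A : vfield A (@psi11 R) =
  fun X => (- (2 * pi) * \sum_k crd k (A X) * crd k X)%:C%C * psi11 X.
Proof. by apply/funext => X; rewrite /vfield dird_psi. Qed.

Lemma dird_bigsum (I : Type) (r : seq I) (F : I -> fct) v :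
  (forall i, smooth (F i)) ->
  dird v (fun X => \sum_(i <- r) F i X) = fun X => \sum_(i <- r) dird v (F i) X.
Proof.
move=> hF; elim: r => [|i r IH].
  rewrite (_ : (fun X => _) = fun=> 0); last by apply/funext => X; rewrite big_nil.
  by rewrite dird_cst; apply/funext => X; rewrite big_nil.
rewrite (_ : (fun X => _) = fun X => F i X + \sum_(i <- r) F i X); last first.
  by apply/funext => X; rewrite big_cons.
rewrite dirdD //; last exact: smooth_sum.
by rewrite IH; apply/funext => X; rewrite big_cons.
Qed.

(** The coefficients of the field are linear forms, so the commutator of the derivative along v with
    the field is the constant derivative along A v. *)
Lemma dird_vfield (A : {linear tsp -> tsp}) f v : smooth f ->
  dird v (vfield A f) = fun X => vfield A (dird v f) X + dird (A v) f X.
Proof.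
move=> sf; have sk k : smooth (fun X => (crd k (A X))%:C%C) by exact: (smooth_scalar (crd k \o A)).
have sd w : smooth (dird w f) by exact: smooth_dird.
rewrite vfieldE // dird_bigsum; last by move=> k; apply: smoothM.
rewrite vfieldE //; apply/funext => X; rewrite (dird_sum (A v)) // -big_split.
apply: eq_bigr => k _; rewrite dirdM // (dird_scalar (crd k \o A)) /=.
by rewrite addrC (dirdC _ _ sf).
Qed.

(** The second-order terms agree by symmetry of second derivatives, and the first-order terms are
    the derivatives along B (A X) and A (B X). *)
Lemma vfieldC (A B : {linear tsp -> tsp}) f : smooth f -> (forall X, A (B X) = B (A X)) ->
  vfield A (vfield B f) = vfield B (vfield A f).
Proof.
move=> sf AB; apply/funext => X; rewrite {1}/vfield dird_vfield // [RHS]/vfield dird_vfield //.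
by rewrite AB /vfield dirdC.
Qed.

(** * Stability of [T11] under multiplication by polynomials and under derivatives *)

Lemma poly_sum (I : Type) (r : seq I) (F : I -> fct) :
  (forall i, polyfun (F i)) -> polyfun (fun X => \sum_(i <- r) F i X).
Proof.
move=> hF; elim: r => [|i r IH].
  by rewrite (_ : (fun X => _) = fun=> 0); [exact: poly_cst|apply/funext => X; rewrite big_nil].
rewrite (_ : (fun X => _) = fun X => F i X + \sum_(i <- r) F i X); first exact: poly_add.
by apply/funext => X; rewrite big_cons.
Qed.

Lemma poly_dird f v : polyfun f -> polyfun (dird v f).
Proof.
elim=> [z|l|P Q pP hP pQ hQ|P Q pP hP pQ hQ].
- by rewrite dird_cst; exact: poly_cst.
- by rewrite dird_scalar; exact: poly_cst.
- by rewrite dirdD; [exact: poly_add|exact: smooth_poly..].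
- by rewrite dirdM; [apply: poly_add; exact: poly_mul|exact: smooth_poly..].
Qed.

Lemma T11P P : polyfun P -> T11 (fun X => P X * psi11 X).
Proof. by exists P. Qed.

Lemma T11_smooth f : T11 f -> smooth f.
Proof. by case=> P pP ->; apply: smoothM; [exact: smooth_poly|exact: smooth_psi]. Qed.

Lemma T11D f g : T11 f -> T11 g -> T11 (f + g).
Proof.
case=> P pP -> [Q pQ ->]; rewrite (_ : _ + _ = fun X => (P X + Q X) * psi11 X).
  by apply: T11P; exact: poly_add.
by apply/funext => X; rewrite mulrDl fctE.
Qed.

Lemma T11M P f : polyfun P -> T11 f -> T11 (fun X => P X * f X).
Proof.
move=> pP [Q pQ ->]; rewrite (_ : (fun X => _) = fun X => (P X * Q X) * psi11 X).
  by apply: T11P; exact: poly_mul.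
by apply/funext => X; rewrite mulrA.
Qed.

Lemma T11Z z f : T11 f -> T11 (z *: f).
Proof. by move=> Tf; apply: (T11M (poly_cst z)). Qed.

Lemma T110 : T11 (0 : fct).
Proof.
rewrite (_ : 0 = fun X => (fun=> 0) X * psi11 X); first by apply: T11P; exact: poly_cst.
by apply/funext => X; rewrite mul0r.
Qed.

Lemma T11N f : T11 f -> T11 (- f).
Proof. by move=> Tf; rewrite -scaleN1r; exact: T11Z. Qed.

Lemma T11_sum (I : Type) (r : seq I) (P : pred I) (F : I -> fct) :
  (forall i, P i -> T11 (F i)) -> T11 (\sum_(i <- r | P i) F i).
Proof. by move=> hF; apply: big_ind => //; [exact: T110|exact: T11D]. Qed.

Lemma T11_dird f v : T11 f -> T11 (dird v f).
Proof.
case=> P pP ->; rewrite dirdM; [|exact: smooth_poly|exact: smooth_psi].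
apply: T11D; first by apply: T11P; exact: poly_dird.
rewrite dird_psi; apply: T11M => //; apply: T11P.
rewrite (_ : (fun X => _) =
  fun X => (- (2 * pi))%:C%C * \sum_k (crd k v)%:C%C * (crd k X)%:C%C).
  apply: poly_mul; first exact: poly_cst.
  by apply: poly_sum => k; apply: poly_mul; [exact: poly_cst|exact: (poly_lin (crd k))].
apply/funext => X; rewrite rmorphM rmorph_sum; congr (_ * _).
by apply: eq_bigr => k _; rewrite rmorphM.
Qed.

Lemma T11_vfield (A : {linear tsp -> tsp}) f : T11 f -> T11 (vfield A f).
Proof.
move=> Tf; rewrite vfieldE; last exact: T11_smooth.
rewrite -fct_sumE; apply: T11_sum => k _; apply: T11M; last exact: T11_dird.
exact: (poly_lin (crd k \o A)).
Qed.

End Coordinates.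

(** * One-parameter subgroups of U(1,1) *)

Section OneParameter.
Variable R : realType.
Local Notation C := R[i].
Local Notation cRe := (@complex.Re R).
Local Notation cIm := (@complex.Im R).
Local Notation tsp := (tsp R).
Local Notation fct := (tsp -> C).
Local Notation idx := ('I_3 + 'I_4)%type.
Implicit Types (X Y v w : tsp) (f g : fct) (al be br bi : R).

Lemma is_cderive_bigsum (I : Type) (r : seq I) (F : I -> R -> C) (d : I -> C) (s : R) :
  (forall i, is_cderive (F i) s (d i)) ->
  is_cderive (fun t => \sum_(i <- r) F i t) s (\sum_(i <- r) d i).
Proof.
move=> hF; elim: r => [|i r IH].
  rewrite big_nil (_ : (fun t => _) = fun=> 0); first exact: is_cderive_cst.
  by apply/funext => t; rewrite big_nil.
rewrite big_cons (_ : (fun t => _) = fun t => F i t + \sum_(i <- r) F i t).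
  exact: is_cderiveD.
by apply/funext => t; rewrite big_cons.
Qed.

Lemma is_cderive_opp (h : R -> C) z :
  is_cderive h 0 z -> is_cderive (fun s => h (- s)) 0 (- z).
Proof.
case=> h1 h2; rewrite -(oppr0 R) in h1 h2.
split.
  apply: (is_derive_cast (is_derive1_comp h1 (is_deriveNid _ _))).
  by rewrite mulrN1; case: z {h1 h2}.
apply: (is_derive_cast (is_derive1_comp h2 (is_deriveNid _ _))).
by rewrite mulrN1; case: z {h1 h2}.
Qed.

Definition is_mxderive m n (A : R -> 'M[C]_(m, n)) (s : R) (B : 'M[C]_(m, n)) :=
  forall j k, is_cderive (fun t => A t j k) s (B j k).

Lemma is_mxderive_mul m n p (A : R -> 'M[C]_(m, n)) (B : R -> 'M[C]_(n, p)) s A' B' :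
  is_mxderive A s A' -> is_mxderive B s B' ->
  is_mxderive (fun t => A t *m B t) s (A' *m B s + A s *m B').
Proof.
move=> hA hB j k; rewrite (_ : (fun t => _) = fun t => \sum_l A t j l * B t l k).
  apply: is_cderive_eq.
    by apply: is_cderive_bigsum => l; exact: is_cderiveM (hA j l) (hB l k).
  by rewrite !mxE -big_split.
by apply/funext => t; rewrite mxE.
Qed.

Lemma is_mxderive_cst m n (A : 'M[C]_(m, n)) s : is_mxderive (fun=> A) s 0.
Proof. by move=> j k; rewrite mxE; exact: is_cderive_cst. Qed.

Lemma sum_ord2 (V : nmodType) (F : 'I_2 -> V) : \sum_i F i = F 0 + F 1.
Proof. by rewrite !big_ord_recl big_ord0 addr0; congr (_ + F _); exact/val_inj. Qed.

Definition umat al be br bi : 'M[C]_2 :=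
  mx2 (0 +i* al)%C (br +i* bi)%C (br -i* bi)%C (0 +i* be)%C.

(** Evaluating skewness at the pairs (e1, e1), (e1, e2), (e2, e2) makes the diagonal imaginary and
    the off-diagonal entries conjugate. *)
Lemma uV_umat L : uV L -> exists al be br bi, L = umat al be br bi.
Proof.
move=> hL.
have := hL (col2 1 0) (col2 1 0); have := hL (col2 1 0) (col2 0 1).
have := hL (col2 0 1) (col2 0 1).
rewrite /hform !mxE !sum_ord2 !mxE /=.
case e00: (L 0 0) => [p00 q00]; case e01: (L 0 1) => [p01 q01].
case e10: (L 1 0) => [p10 q10]; case e11: (L 1 1) => [p11 q11].
move=> [] /= h1 h2 [] /= h3 h4 [] /= h5 h6.
exists q00, q11, p01, q01; apply/matrixP => j k; rewrite mxE.
have I2P (i : 'I_2) : i = 0 \/ i = 1.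
  by case: i => [[|[|//]] hj]; [left | right]; exact/val_inj.
have [->|->] := I2P j; have [->|->] := I2P k; rewrite /= ?e00 ?e01 ?e10 ?e11;
  congr (_ +i* _)%C; lra.
Qed.

Lemma umat_uV al be br bi : uV (umat al be br bi).
Proof.
move=> u v; rewrite /hform !mxE !sum_ord2 !mxE /=.
case: (u 0 0) (u 1 0) (v 0 0) (v 1 0) => [? ?] [? ?] [? ?] [? ?].
by apply/eqP; rewrite eq_complex /=; apply/andP; split; apply/eqP; ring.
Qed.

(* The vector field X |-> ([L, x], L u) for L = umat al be br bi. *)
Definition xi al be br bi X : tsp :=
  let c j := su_coord j X in let d j := V_coord j X in
  tcoord
    (\row_j [:: 2 * (bi * c 1 - br * c 2%:R);
                (be - al) * c 2%:R + 2 * bi * c 0;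
                (al - be) * c 1 - 2 * br * c 0]`_j)
    (\row_j [:: br * d 2%:R - bi * d 3%:R - al * d 1;
                al * d 0 + br * d 3%:R + bi * d 2%:R;
                br * d 0 + bi * d 1 - be * d 3%:R;
                br * d 1 - bi * d 0 + be * d 2%:R]`_j).

Fact xi_is_linear al be br bi : linear (xi al be br bi).
Proof.
move=> a X Y; rewrite /xi -tcoord_linear.
have hs j : su_coord j (a *: X + Y) = a * su_coord j X + su_coord j Y.
  exact: (crd_is_scalar (inl j)).
have hV j : V_coord j (a *: X + Y) = a * V_coord j X + V_coord j Y.
  exact: (crd_is_scalar (inr j)).
congr tcoord; apply/rowP => j; rewrite !mxE ?hs ?hV.
  by case: j => [[|[|[|//]]] ?] /=; ring.
by case: j => [[|[|[|[|//]]]] ?] /=; ring.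
Qed.
HB.instance Definition _ al be br bi :=
  GRing.isLinear.Build R tsp tsp _ (xi al be br bi) (xi_is_linear al be br bi).

Section Flow.
Variables (gam : R -> UV R) (al be br bi : R).
Let L := umat al be br bi.
Hypothesis gamL : one_param gam L.

Lemma one_param_inv s : invmx (gam s) = gam (- s).
Proof.
case: gamL => g0 gD _; rewrite -[LHS]mulmx1 -g0 -(subrr s) gD mulKmx //.
by case: (gam s) => ? [].
Qed.

(** [fun_act] moves the point by the inverse, so the orbit is (gam(-s) x gam(s), gam(-s) u). The
    product rule at 0 gives ([x, L], - L u), whence the sign. *)
Lemma velocity_orbit X : velocity (fun s => tact (UVinv (gam s)) X) (- xi al be br bi X).
Proof.
case: (gamL) => g0 gD gd.
have hg : is_mxderive (fun s => gval (gam s)) 0 L by [].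
have hgN : is_mxderive (fun s => gval (gam (- s))) 0 (- L).
  by move=> j k; rewrite mxE; exact: (is_cderive_opp (gd j k)).
have hx : is_mxderive (fun s => xpart (tact (UVinv (gam s)) X)) 0
    (xpart X *m L - L *m xpart X).
  rewrite (_ : (fun s => _) = fun s => (gam (- s) *m xpart X) *m gam s); last first.
    by apply/funext => s; rewrite /xpart /= invmxK one_param_inv.
  move=> j k; apply: is_cderive_eq.
    exact: (is_mxderive_mul (is_mxderive_mul hgN (is_mxderive_cst _ _)) hg).
  by rewrite /= oppr0 g0 !(mulmx0, addr0, mul1mx, mulmx1) mulNmx addrC.
have hu : is_mxderive (fun s => upart (tact (UVinv (gam s)) X)) 0 (- (L *m upart X)).
  rewrite (_ : (fun s => _) = fun s => gam (- s) *m upart X); last first.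
    by apply/funext => s; rewrite /upart /= one_param_inv.
  move=> j k; apply: is_cderive_eq.
    exact: (is_mxderive_mul hgN (is_mxderive_cst _ _)).
  by rewrite mulmx0 addr0 mulNmx.
have twice (h : R -> R) d e : is_derive (0 : R) 1 h d -> 2 * d = e ->
    is_derive (0 : R) 1 (fun s => 2 * h s) e.
  by move=> hd <-; exact: (is_deriveZ 2 hd).
have [h11 h00 h10] := suV_entries X.
case=> [[[|[|[|//]]] ?]|[[|[|[|[|//]]]] ?]]; rewrite linearN /= ?su_coordK ?V_coordK !mxE /=.
- rewrite {1}/su_coord /=; apply: (twice _ _ _ (hx 0 0).2).
  rewrite !mxE !sum_ord2 /su_coord !mxE /= ?h11 ?h10.
  by case: (xpart X 0 0) h00 => a b /= ->; case: (xpart X 0 1) => c d /=; ring.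
- rewrite {1}/su_coord /=; apply: (twice _ _ _ (hx 0 1).1).
  rewrite !mxE !sum_ord2 /su_coord !mxE /= ?h11 ?h10.
  by case: (xpart X 0 0) h00 => a b /= ->; case: (xpart X 0 1) => c d /=; ring.
- rewrite {1}/su_coord /=; apply: (twice _ _ _ (hx 0 1).2).
  rewrite !mxE !sum_ord2 /su_coord !mxE /= ?h11 ?h10.
  by case: (xpart X 0 0) h00 => a b /= ->; case: (xpart X 0 1) => c d /=; ring.
- rewrite {1}/V_coord /=; apply: (twice _ _ _ (hu 0 0).1).
  rewrite !mxE !sum_ord2 /V_coord !mxE /=.
  by case: (upart X 0 0) (upart X 1 0) => a b [c d] /=; ring.
- rewrite {1}/V_coord /=; apply: (twice _ _ _ (hu 0 0).2).
  rewrite !mxE !sum_ord2 /V_coord !mxE /=.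
  by case: (upart X 0 0) (upart X 1 0) => a b [c d] /=; ring.
- rewrite {1}/V_coord /=; apply: (twice _ _ _ (hu 1 0).1).
  rewrite !mxE !sum_ord2 /V_coord !mxE /=.
  by case: (upart X 0 0) (upart X 1 0) => a b [c d] /=; ring.
- rewrite {1}/V_coord /=; apply: (twice _ _ _ (hu 1 0).2).
  rewrite !mxE !sum_ord2 /V_coord !mxE /=.
  by case: (upart X 0 0) (upart X 1 0) => a b [c d] /=; ring.
Qed.

(** The right-hand side depends on L alone, so the choice of [gam] in [lie_act] does not affect the
    result. *)
Lemma lie_actE f : smooth f ->
  (fun X => cderive (fun s => fun_act (gam s) f X) 0) = - vfield (xi al be br bi) f.
Proof.
move=> sf; apply/funext => X; apply: cderiveE.
apply: (is_cderive_eq (smooth_curve sf (velocity_orbit X))).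
have -> : tact (UVinv (gam 0)) X = X.
  apply/val_inj; rewrite /= invmxK one_param_inv oppr0.
  by case: gamL => -> _ _; rewrite !mul1mx mulmx1 /xpart /upart; case: (val X).
have := dird_linear (xi al be br bi X) 0 (-1) X sf.
rewrite scaleN1r addr0 => ->; rewrite rmorphN mulN1r /vfield.
have -> : dird 0 f X = 0.
  have := dird_linear 0 0 (-1) X sf.
  by rewrite scaleN1r addr0 rmorphN mulN1r oppr0 addNr.
by rewrite addr0.
Qed.

(** P is constant along orbits. The subgroup [gam] is what turns invariance under the group into
    invariance under L. *)
Lemma vfield_invariant P : inv_polyfun P -> vfield (xi al be br bi) P = 0.
Proof.
case=> pP hP; apply/eqP; rewrite -oppr_eq0 -(lie_actE (smooth_poly pP)); apply/eqP.
apply/funext => X; apply: cderiveE.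
rewrite (_ : (fun s => _) = fun=> P X); first exact: is_cderive_cst.
by apply/funext => s; rewrite hP.
Qed.

End Flow.

(** * Existence of one-parameter subgroups in the compact and noncompact directions *)

Lemma is_unitary_mx2 (a b c d : C) : mx2 a b c d \in unitmx ->
  (a^*)%C * a - (c^*)%C * c = 1 -> (b^*)%C * b - (d^*)%C * d = -1 ->
  (a^*)%C * b - (c^*)%C * d = 0 -> (b^*)%C * a - (d^*)%C * c = 0 ->
  Defs.is_unitary (mx2 a b c d).
Proof.
move=> hU h1 h2 h3 h4; split=> // u v; rewrite /hform !mxE !sum_ord2 !mxE /=.
rewrite !(rmorphD, rmorphM) /=.
transitivity (((a^*)%C * a - (c^*)%C * c) * (u 0 0)^*%C * v 0 0 +
  ((b^*)%C * b - (d^*)%C * d) * (u 1 0)^*%C * v 1 0 +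
  ((a^*)%C * b - (c^*)%C * d) * (u 0 0)^*%C * v 1 0 +
  ((b^*)%C * a - (d^*)%C * c) * (u 1 0)^*%C * v 0 0);
  first by ring.
by rewrite h1 h2 h3 h4; ring.
Qed.

Lemma mx2M (a b c d a' b' c' d' : C) : mx2 a b c d *m mx2 a' b' c' d' =
  mx2 (a * a' + b * c') (a * b' + b * d') (c * a' + d * c') (c * b' + d * d').
Proof.
apply/matrixP => j k; rewrite !mxE sum_ord2 !mxE /=.
by case: ifP => _; case: ifP => _.
Qed.

Lemma mx2_1 : mx2 1 0 0 1 = 1%:M :> 'M[C]_2.
Proof.
by apply/matrixP => -[[|[|//]] ?] [[|[|//]] ?]; rewrite !mxE /=.
Qed.

Definition expi (t : R) : C := (cos t +i* sin t)%C.

Lemma expiD s t : expi (s + t) = expi s * expi t.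
Proof. by rewrite /expi cosD sinD; congr (_ +i* _)%C; ring. Qed.

Lemma expi0 : expi 0 = 1. Proof. by rewrite /expi cos0 sin0. Qed.

Lemma expi_conj t : (expi t)^*%C * expi t = 1.
Proof.
apply/eqP; rewrite eq_complex /=; apply/andP; split; apply/eqP; last by ring.
by rewrite -(cos2Dsin2 t); ring.
Qed.

Lemma is_cderive_expi al : is_cderive (fun s => expi (al * s)) 0 (0 +i* al)%C.
Proof.
have hal : is_derive (0 : R) 1 (fun s => al * s) al.
  by apply: (is_derive_cast (is_deriveZ al (is_derive_id _ _))); rewrite /GRing.scale /= mulr1.
split => /=.
  apply: (is_derive_cast (is_derive1_comp (is_derive_cos _) hal)).
  by rewrite mulr0 sin0 oppr0 mul0r.
apply: (is_derive_cast (is_derive1_comp (is_derive_sin _) hal)).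
by rewrite mulr0 cos0 mul1r.
Qed.

Lemma one_param_compact al be : exists gam, one_param gam (umat al be 0 0).
Proof.
have e1 s t : mx2 (expi s) 0 0 (expi t) *m mx2 (expi (- s)) 0 0 (expi (- t)) = 1%:M.
  by rewrite mx2M -!expiD !subrr expi0 !(mulr0, mul0r, addr0, add0r) mx2_1.
have hU s : Defs.is_unitary (mx2 (expi (al * s)) 0 0 (expi (be * s))).
  apply: is_unitary_mx2; rewrite ?expi_conj ?conjc0 ?(mulr0, mul0r, subr0, sub0r, oppr0) //.
  by have [] := mulmx1_unit (e1 (al * s) (be * s)).
exists (fun s => MkUV (hU s)); split=> [|s t|j k] /=.
- by rewrite !mulr0 expi0 mx2_1.
- by rewrite mx2M !mulrDr !expiD !(mulr0, mul0r, addr0, add0r).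
- rewrite (_ : (fun s => _) = fun s => if j == 0 then (if k == 0 then expi (al * s) else 0)
     else (if k == 0 then 0 else expi (be * s))); last first.
    by apply/funext => s; rewrite mxE.
  rewrite mxE; case: ifP => _; case: ifP => _; try exact: is_cderive_expi;
  by apply: (is_cderive_eq (is_cderive_cst _ _)); rewrite ?oppr0.
Qed.

(** For |b| = 1 the matrix N = [umat 0 0 br bi] satisfies N^2 = 1, so exp(s N) = cosh s + (sinh s)
    N. The cases b = 1 and b = i are the ones applied later. *)
Lemma one_param_hyperbolic br bi : br ^+ 2 + bi ^+ 2 = 1 ->
  exists gam, one_param gam (umat 0 0 br bi).
Proof.
move=> hb.
pose ch s : R := (expR s + expR (- s)) / 2; pose sh s : R := (expR s - expR (- s)) / 2.
have hN (s : R) : expR s * expR (- s) = 1 by rewrite -expRD subrr expR0.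
have h1 s : ch s ^+ 2 - sh s ^+ 2 = 1.
  by transitivity (expR s * expR (- s)) => //; rewrite /ch /sh; field.
have chD s t : ch (s + t) = ch s * ch t + sh s * sh t.
  by rewrite /ch /sh opprD !expRD; field.
have shD s t : sh (s + t) = ch s * sh t + sh s * ch t.
  by rewrite /ch /sh opprD !expRD; field.
have ch0 : ch 0 = 1 by rewrite /ch oppr0 expR0; field.
have sh0 : sh 0 = 0 by rewrite /sh oppr0 expR0; field.
have dch : is_derive (0 : R) 1 ch 0.
  rewrite (_ : ch = 2^-1 \*: (expR + (expR \o -%R))); last first.
    by apply/funext => s; rewrite /ch /sh; exact: mulrC.
  apply: (is_derive_cast (is_deriveZ _ (is_deriveD (is_derive_expR _)
     (is_derive1_comp (is_derive_expR _) (is_deriveNid _ _))))).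
  by rewrite oppr0 expR0 /GRing.scale /=; ring.
have dsh : is_derive (0 : R) 1 sh 1.
  rewrite (_ : sh = 2^-1 \*: (expR - (expR \o -%R))); last first.
    by apply/funext => s; rewrite /ch /sh; exact: mulrC.
  apply: (is_derive_cast (is_deriveZ _ (is_deriveB (is_derive_expR _)
     (is_derive1_comp (is_derive_expR _) (is_deriveNid _ _))))).
  by rewrite oppr0 expR0 /GRing.scale /=; field.
(* From here on the hyperbolic functions are known only through their addition formulas, ch^2 - sh^2
   = 1, and their values and derivatives at 0. *)
clearbody ch sh.
pose b := (br +i* bi)%C; pose bc := (br -i* bi)%C.
have bbc : b * bc = 1.
  apply/eqP; rewrite eq_complex /=; apply/andP; split; apply/eqP; last by ring.
  by rewrite -hb; ring.
have conjb : (b^*)%C = bc by [].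
have conjbc : (bc^*)%C = b by rewrite -conjb conjcK.
pose g s := mx2 (ch s)%:C%C (b * (sh s)%:C%C) (bc * (sh s)%:C%C) (ch s)%:C%C.
have gD s t : g (s + t) = g s *m g t.
  rewrite mx2M /g chD shD !(rmorphD, rmorphM) /=; congr mx2; last 3 first.
  - by ring.
  - by ring.
  - by transitivity ((ch s)%:C%C * (ch t)%:C%C + b * bc * ((sh s)%:C%C * (sh t)%:C%C));
      [rewrite bbc; ring|ring].
  by transitivity ((ch s)%:C%C * (ch t)%:C%C + b * bc * ((sh s)%:C%C * (sh t)%:C%C));
      [rewrite bbc; ring|ring].
have g0 : g 0 = 1%:M by rewrite /g ch0 sh0 !mulr0 mx2_1.
have cR (r : R) : (r%:C^*)%C = r%:C%C by rewrite /real_complex_def /= oppr0.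
have conjM (y z : C) : ((y * z)^*)%C = (y^*)%C * (z^*)%C by exact: rmorphM.
have h1C s : (ch s)%:C%C * (ch s)%:C%C - b * bc * ((sh s)%:C%C * (sh s)%:C%C) = 1.
  by rewrite bbc mul1r -!rmorphM -rmorphB /= -!expr2 h1.
have hU s : Defs.is_unitary (g s).
  apply: is_unitary_mx2; rewrite ?conjM ?cR ?conjb ?conjbc.
  - by have [] := @mulmx1_unit _ _ (g s) (g (- s)); rewrite -?gD ?subrr.
  - by rewrite -[RHS](h1C s); ring.
  - by rewrite -[in RHS](h1C s); ring.
  - by ring.
  - by ring.
exists (fun s => MkUV (hU s)); split=> // j k /=.
have dz z : is_cderive (fun s => z * (sh s)%:C%C) 0 z.
  apply: (is_cderive_eq (is_cderiveM (is_cderive_cst _ _) (is_cderive_real dsh))).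
  by rewrite mul0r add0r mulr1.
rewrite (_ : (fun s => _) = fun s => if j == 0 then (if k == 0 then (ch s)%:C%C else b * (sh s)%:C%C)
     else (if k == 0 then bc * (sh s)%:C%C else (ch s)%:C%C)); last first.
  by apply/funext => s; rewrite mxE.
by rewrite mxE; case: ifP => _; case: ifP => _; try exact: dz;
  exact: (is_cderive_real dch).
Qed.

End OneParameter.

(** * Linear spans *)

Section Span.
Variables (F : pzRingType) (E : lmodType F).
Implicit Types (S : set E) (v w : E).

Lemma lspan_in S v : S v -> lspan S v.
Proof.
by move=> Sv; exists 1, (fun=> 1), (fun=> v); rewrite big_ord1 scale1r; split.
Qed.

Lemma lspan0 S : lspan S 0.
Proof. by exists 0, (fun=> 0), (fun=> 0); rewrite big_ord0; split=> // -[]. Qed.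

Lemma lspanD S v w : lspan S v -> lspan S w -> lspan S (v + w).
Proof.
move=> [n [c [u [hu ->]]]] [m [d [t [ht ->]]]].
exists (n + m)%N, (fun i => match fintype.split i with inl j => c j | inr j => d j end),
  (fun i => match fintype.split i with inl j => u j | inr j => t j end).
split=> [i|]; first by case: (fintype.split i).
rewrite big_split_ord; congr (_ + _); apply: eq_bigr => i _.
  by rewrite (unsplitK (inl i)).
by rewrite (unsplitK (inr i)).
Qed.

Lemma lspanZ S a v : lspan S v -> lspan S (a *: v).
Proof.
move=> [n [c [u [hu ->]]]]; exists n, (fun i => a * c i), u; split=> //.
by rewrite scaler_sumr; apply: eq_bigr => i _; rewrite scalerA.
Qed.

Lemma lspan_ind S (P : set E) : P 0 ->
  (forall a v w, S v -> P w -> P (a *: v + w)) -> lspan S `<=` P.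
Proof.
move=> P0 PD _ [n [c [u [hu ->]]]].
by elim/big_rec: _ => // i w _; exact: PD.
Qed.

End Span.

(** * The action on coinvariants *)

Section Action.
Variable R : realType.
Local Notation C := R[i].
Local Notation tsp := (tsp R).
Local Notation fct := (tsp -> C).
Local Notation idx := ('I_3 + 'I_4)%type.
Local Notation K := (@coinv_rel R).
Implicit Types (X Y v w : tsp) (f g : fct) (al be br bi : R) (D : fct -> fct).

Lemma vfield_linear A a f g : smooth f -> smooth g ->
  vfield A (a *: f + g) = a *: vfield A f + vfield A g.
Proof.
move=> sf sg; rewrite -vfieldZ //; apply: (vfieldD A _ sg).
by apply: (smoothM _ sf); exact: smooth_cst.
Qed.

Lemma dird_clinear v a f g : smooth f -> smooth g ->
  dird v (a *: f + g) = a *: dird v f + dird v g.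
Proof.
move=> sf sg; rewrite -dirdZ //; apply: (dirdD v _ sg).
by apply: (smoothM _ sf); exact: smooth_cst.
Qed.

#[local] Opaque dird.

(** These conditions make D act on the quotient. Commutation is required only for those L that come
    with a one-parameter subgroup: every generator of [coinv_rel] supplies one, and
    [vfield_invariant] consumes one. *)
Definition equivariant D :=
  [/\ forall f, T11 f -> T11 (D f),
      forall a f g, T11 f -> T11 g -> D (a *: f + g) = a *: D f + D g
    & forall gam al be br bi f, one_param gam (umat al be br bi) -> T11 f ->
      D (vfield (xi al be br bi) f) = vfield (xi al be br bi) (D f)].

(** Used for the Weil operators, whose expression through vector fields and Laplacians is
    established on [T11] only. *)
Lemma equivariant_eq D D' : equivariant D -> (forall f, T11 f -> D' f = D f) ->
  equivariant D'.
Proof.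
move=> [h1 h2 h3] e; split=> [f Tf|a f g Tf Tg|gam al be br bi f hg Tf].
- by rewrite e //; exact: h1.
- by rewrite !e ?h2 //; apply: T11D => //; exact: T11Z.
- by rewrite !e ?(h3 gam) //; exact: T11_vfield.
Qed.

Lemma equivariant_id : equivariant id. Proof. by split. Qed.

Lemma equivariant_add D D' : equivariant D -> equivariant D' ->
  equivariant (fun f => D f + D' f).
Proof.
move=> [h1 h2 h3] [k1 k2 k3]; split=> [f Tf|a f g Tf Tg|gam al be br bi f hg Tf].
- by apply: T11D; [exact: h1|exact: k1].
- by rewrite h2 // k2 // scalerDr addrACA.
- rewrite (h3 gam) // (k3 gam) //; symmetry.
  by apply: vfieldD; apply: T11_smooth; [exact: h1|exact: k1].
Qed.

Lemma equivariant_scale z D : equivariant D -> equivariant (fun f => z *: D f).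
Proof.
move=> [h1 h2 h3]; split=> [f Tf|a f g Tf Tg|gam al be br bi f hg Tf].
- by apply: T11Z; exact: h1.
- by rewrite h2 // scalerDr !scalerA mulrC.
- by rewrite (h3 gam) // vfieldZ //; apply: T11_smooth; exact: h1.
Qed.

Lemma equivariant_comp D D' : equivariant D -> equivariant D' -> equivariant (D \o D').
Proof.
move=> [h1 h2 h3] [k1 k2 k3]; split=> [f Tf|a f g Tf Tg|gam al be br bi f hg Tf] /=.
- by apply: h1; exact: k1.
- by rewrite k2 // h2 //; exact: k1.
- by rewrite (k3 gam) // (h3 gam) //; exact: k1.
Qed.

Lemma equivariant_mul P : inv_polyfun P -> equivariant (fun f X => P X * f X).
Proof.
move=> hP; have [pP _] := hP.
split=> [f Tf|a f g Tf Tg|gam al be br bi f hg Tf].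
- exact: T11M.
- by apply/funext => X; rewrite !fctE /GRing.scale /=; ring.
- rewrite vfieldM; [|exact: smooth_poly|exact: T11_smooth].
  by rewrite (vfield_invariant hg hP); apply/funext => X; rewrite mul0r add0r.
Qed.

Lemma equivariant_vfield (B : {linear tsp -> tsp}) :
  (forall al be br bi X, B (xi al be br bi X) = xi al be br bi (B X)) ->
  equivariant (vfield B).
Proof.
move=> hB; split=> [f Tf|a f g Tf Tg|gam al be br bi f hg Tf].
- exact: T11_vfield.
- by rewrite vfield_linear //; exact: T11_smooth.
- by apply: vfieldC; [exact: T11_smooth|exact: hB].
Qed.

(** * The operators of the Weil representation commute with u(V) *)

Definition laplace (e : idx -> R) f : fct :=
  \sum_k (e k)%:C%C *: dird (bas R k) (dird (bas R k) f).

Lemma T11_laplace e f : T11 f -> T11 (laplace e f).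
Proof. by move=> Tf; apply: T11_sum => k _; apply: T11Z; do 2!apply: T11_dird. Qed.

Lemma laplaceE e f X :
  laplace e f X = \sum_k (e k)%:C%C * dird (bas R k) (dird (bas R k) f) X.
Proof. by rewrite /laplace fct_sumE. Qed.

(* The antisymmetry hypothesis says that xi preserves the quadratic form
   sum_k e k * crd k ^+ 2. *)
Lemma laplace_vfield (e : idx -> R) (A : {linear tsp -> tsp}) f : smooth f ->
  (forall j k, e k * crd j (A (bas R k)) = - (e j * crd k (A (bas R j)))) ->
  laplace e (vfield A f) = vfield A (laplace e f).
Proof.
move=> sf hA; have sd u := smooth_dird u sf; have sdd u := smooth_dird u (sd u).
have sA := smooth_vfield A sf.
apply/funext => X; rewrite laplaceE.
have -> : vfield A (laplace e f) X =
    \sum_k (e k)%:C%C * vfield A (dird (bas R k) (dird (bas R k) f)) X.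
  rewrite /vfield /laplace fct_sumE dird_bigsum.
    by apply: eq_bigr => k _; rewrite dirdZ.
  by move=> k; apply: (smoothM _ (sdd _)); exact: smooth_cst.
pose s k := dird (bas R k) (dird (A (bas R k)) f) X.
(* Moving each of the two derivatives past the field costs one derivative along A (bas k); by
   symmetry of second derivatives the two costs are equal. *)
have e2 k : dird (bas R k) (dird (bas R k) (vfield A f)) X =
    vfield A (dird (bas R k) (dird (bas R k) f)) X + 2 * s k.
  rewrite dird_vfield // dirdD //; last exact: smooth_vfield.
  by rewrite dird_vfield // /s (dirdC _ (A _)) // mulrDl mul1r addrA.
transitivity (\sum_k ((e k)%:C%C * vfield A (dird (bas R k) (dird (bas R k) f)) X +
    2 * ((e k)%:C%C * s k))).
  by apply: eq_bigr => k _; rewrite e2 mulrDr [in RHS]mulrCA.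
rewrite big_split /= -mulr_sumr.
rewrite -[RHS]addr0; congr (_ + _).
suff -> : \sum_k (e k)%:C%C * s k = 0 by rewrite mulr0.
pose M k j : C := (e k * crd j (A (bas R k)))%:C%C.
pose d k j : C := dird (bas R j) (dird (bas R k) f) X.
have -> : \sum_k (e k)%:C%C * s k = \sum_k \sum_j M k j * d k j.
  apply: eq_bigr => k _; rewrite /s dirdC // dird_sum // mulr_sumr.
  by apply: eq_bigr => j _; rewrite mulrA -rmorphM.
(* The remaining sum contracts the antisymmetric matrix M with the symmetric Hessian d; exchanging
   the indices changes its sign. *)
set S := \sum_k _; have SN : S = - S.
  rewrite {1}/S exchange_big /= -sumrN; apply: eq_bigr => j _; rewrite -sumrN.
  by apply: eq_bigr => k _; rewrite /M hA rmorphN mulNr /d dirdC.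
have : S *+ 2 = 0 by rewrite mulr2n {1}SN addNr.
by move/eqP; rewrite mulrn_eq0 => /eqP.
Qed.

Lemma equivariant_laplace e :
  (forall al be br bi j k, e k * crd j (xi al be br bi (bas R k)) =
     - (e j * crd k (xi al be br bi (bas R j)))) ->
  equivariant (laplace e).
Proof.
move=> he; split=> [f|a f g Tf Tg|gam al be br bi f hg Tf].
- exact: T11_laplace.
- rewrite /laplace scaler_sumr -big_split; apply: eq_bigr => k _ /=.
  have sf := T11_smooth Tf; have sg := T11_smooth Tg.
  rewrite dird_clinear // dird_clinear; try exact: smooth_dird.
  by rewrite scalerDr !scalerA mulrC.
- by apply: laplace_vfield; [exact: T11_smooth|exact: he].
Qed.

(** Its vector field is the Euler field of su(V), the first-order part of the diagonal element of
    the first sl_2; likewise [proj_V] for V. *)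
Definition proj_su X : tsp := tcoord (\row_j su_coord j X) 0.
Definition proj_V X : tsp := tcoord 0 (\row_j V_coord j X).

Fact proj_su_is_linear : linear proj_su.
Proof.
move=> a X Y; rewrite -tcoord_linear scaler0 addr0; congr tcoord.
by apply/rowP => j; rewrite !mxE; exact: (crd_is_scalar (inl j)).
Qed.
HB.instance Definition _ := GRing.isLinear.Build R tsp tsp _ proj_su proj_su_is_linear.

Fact proj_V_is_linear : linear proj_V.
Proof.
move=> a X Y; rewrite -tcoord_linear scaler0 addr0; congr tcoord.
by apply/rowP => j; rewrite !mxE; exact: (crd_is_scalar (inr j)).
Qed.
HB.instance Definition _ := GRing.isLinear.Build R tsp tsp _ proj_V proj_V_is_linear.

Lemma proj_su_xi al be br bi X : proj_su (xi al be br bi X) = xi al be br bi (proj_su X).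
Proof.
rewrite /proj_su /xi; congr tcoord; apply/rowP => j; rewrite !mxE ?su_coordK ?V_coordK !mxE.
  by [].
by case: j => [[|[|[|[|//]]]] ?] /=; ring.
Qed.

Lemma proj_V_xi al be br bi X : proj_V (xi al be br bi X) = xi al be br bi (proj_V X).
Proof.
rewrite /proj_V /xi; congr tcoord; apply/rowP => j; rewrite !mxE ?su_coordK ?V_coordK !mxE.
  by case: j => [[|[|[|//]]] ?] /=; ring.
by [].
Qed.

Definition sig_su (k : idx) : R :=
  match k with inl j => if (j < 1)%N then 1 else -1 | inr _ => 0 end.
Definition sig_V (k : idx) : R :=
  match k with inl _ => 0 | inr j => if (j < 2)%N then 1 else -1 end.

(** u(V) acts on su(V) through so(1,2) and on V through so(2,2), the Lie algebras of the forms [Q0]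
    and [Q1]. *)
Lemma sig_antisym (e : idx -> R) : e = sig_su \/ e = sig_V ->
  forall al be br bi j k, e k * crd j (xi al be br bi (bas R k)) =
     - (e j * crd k (xi al be br bi (bas R j))).
Proof.
have vb (i : 'I_3) (m : 'I_4) : V_coord m (su_basis R i) = 0 by rewrite V_coordK mxE.
have sb (i : 'I_4) (m : 'I_3) : su_coord m (V_basis R i) = 0 by rewrite su_coordK mxE.
have ss (i m : 'I_3) : su_coord m (su_basis R i) = (m == i)%:R by rewrite su_coordK mxE.
have vv (i m : 'I_4) : V_coord m (V_basis R i) = (m == i)%:R by rewrite V_coordK mxE.
move=> [] -> al be br bi [j|j] [k|k]; rewrite /= ?(mul0r, oppr0) //;
  case: j => [[|[|[|[|//]]]] hj] //; case: k => [[|[|[|[|//]]]] hk] //=;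
  rewrite /xi ?su_coordK ?V_coordK !mxE /= ?(ss, vv, sb, vb) ?eqxx /=; ring.
Qed.

Lemma Q0_inv : inv_polyfun (@Q0 R).
Proof.
split.
  rewrite (_ : @Q0 R = fun X => (2^-1)%:C%C * ((crd (inl 0) X)%:C%C * (crd (inl 0) X)%:C%C +
     (-1) * ((crd (inl 1) X)%:C%C * (crd (inl 1) X)%:C%C +
       (crd (inl 2%:R) X)%:C%C * (crd (inl 2%:R) X)%:C%C))); last first.
    apply/funext => X; rewrite Q0E /= mulrC rmorphM; congr (_ * _).
    by rewrite !rmorphB !rmorphXn /=; ring.
  have pc k := @poly_lin R (@crd R k).
  by do ?[exact: poly_cst|exact: pc|apply: poly_add|apply: poly_mul].
move=> g; apply/funext => X; rewrite /fun_act /Q0 /=; congr (- _).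
rewrite /xpart /=; set h := invmx g.
have hU : h \in unitmx by rewrite unitmx_inv; case: g @h => ? [].
by rewrite -!mulmxA (mulKmx hU) mxtrace_mulC -!mulmxA (mulVmx hU) mulmx1.
Qed.

Lemma Q1_inv : inv_polyfun (@Q1 R).
Proof.
split.
  rewrite (_ : @Q1 R = fun X => (2^-1)%:C%C * ((crd (inr 0) X)%:C%C * (crd (inr 0) X)%:C%C +
     (crd (inr 1) X)%:C%C * (crd (inr 1) X)%:C%C +
     (-1) * ((crd (inr 2%:R) X)%:C%C * (crd (inr 2%:R) X)%:C%C +
       (crd (inr 3%:R) X)%:C%C * (crd (inr 3%:R) X)%:C%C))); last first.
    apply/funext => X; rewrite Q1E /= mulrC rmorphM; congr (_ * _).
    by rewrite !rmorphB rmorphD !rmorphXn /=; ring.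
  have pc k := @poly_lin R (@crd R k).
  by do ?[exact: poly_cst|exact: pc|apply: poly_add|apply: poly_mul].
move=> g; apply/funext => X; rewrite /fun_act /Q1 /upart /=; congr (_ * _).
by case: (UVinv_subproof g) => _; exact.
Qed.

Lemma weil_suE M f : T11 f -> weil_su M f =
  M 0 0 *: ((3 / 2) *: f + vfield proj_su f)
  + M 0 1 *: ((2 * pi%:C%C * 'i%C) *: (fun X => Q0 X * f X))
  + M 1 0 *: (('i%C / (4 * pi%:C%C)) *: laplace sig_su f).
Proof.
move=> Tf; rewrite /weil_su /weil; congr (_ *: (_ + _) + _ *: _ + _ *: (_ *: _)).
- rewrite vfieldE; last exact: T11_smooth.
  apply/funext => X; rewrite fct_sumE big_sumType /= [X in _ = _ + X]big1 ?addr0.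
    by apply: eq_bigr => j _; rewrite /proj_su su_coordK mxE.
  by move=> j _; rewrite /proj_su V_coordK mxE mul0r.
- by apply/funext => X; rewrite -mulrA.
- rewrite /laplace big_sumType /= [X in _ = _ + X]big1 ?addr0; last first.
    by move=> j _; rewrite scale0r.
  rewrite [RHS](bigID (fun j : 'I_3 => (j < 1)%N)) /=; congr (_ + _).
    by apply: eq_bigr => j ->; rewrite scale1r.
  rewrite -sumrN; apply: eq_big => j; first by rewrite -leqNgt.
  by rewrite leqNgt => /negPf ->; rewrite rmorphN scaleN1r.
Qed.

Lemma weil_VE M f : T11 f -> weil_V M f =
  M 0 0 *: ((4 / 2) *: f + vfield proj_V f)
  + M 0 1 *: ((2 * pi%:C%C * 'i%C) *: (fun X => Q1 X * f X))
  + M 1 0 *: (('i%C / (4 * pi%:C%C)) *: laplace sig_V f).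
Proof.
move=> Tf; rewrite /weil_V /weil; congr (_ *: (_ + _) + _ *: _ + _ *: (_ *: _)).
- rewrite vfieldE; last exact: T11_smooth.
  apply/funext => X; rewrite fct_sumE big_sumType /= [X in _ = X + _]big1 ?add0r.
    by apply: eq_bigr => j _; rewrite /proj_V V_coordK mxE.
  by move=> j _; rewrite /proj_V su_coordK mxE mul0r.
- by apply/funext => X; rewrite -mulrA.
- rewrite /laplace big_sumType /= [X in _ = X + _]big1 ?add0r; last first.
    by move=> j _; rewrite scale0r.
  rewrite [RHS](bigID (fun j : 'I_4 => (j < 2)%N)) /=; congr (_ + _).
    by apply: eq_bigr => j ->; rewrite scale1r.
  rewrite -sumrN; apply: eq_big => j; first by rewrite -leqNgt.
  by rewrite leqNgt => /negPf ->; rewrite rmorphN scaleN1r.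
Qed.

Lemma equivariant_weil_su M : equivariant (weil_su M).
Proof.
pose c : C := 2 * pi%:C%C * 'i%C; pose d : C := 'i%C / (4 * pi%:C%C).
have h0 := equivariant_add (equivariant_scale (3 / 2) equivariant_id)
  (equivariant_vfield proj_su_xi).
have h1 := equivariant_scale c (equivariant_mul Q0_inv).
have h2 := equivariant_scale d (equivariant_laplace (sig_antisym (or_introl (erefl sig_su)))).
apply: equivariant_eq (equivariant_add (equivariant_add (equivariant_scale (M 0 0) h0)
  (equivariant_scale (M 0 1) h1)) (equivariant_scale (M 1 0) h2)) _.
by move=> f Tf; rewrite weil_suE.
Qed.

Lemma equivariant_weil_V M : equivariant (weil_V M).
Proof.
pose c : C := 2 * pi%:C%C * 'i%C; pose d : C := 'i%C / (4 * pi%:C%C).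
have h0 := equivariant_add (equivariant_scale (4 / 2) equivariant_id)
  (equivariant_vfield proj_V_xi).
have h1 := equivariant_scale c (equivariant_mul Q1_inv).
have h2 := equivariant_scale d (equivariant_laplace (sig_antisym (or_intror (erefl sig_V)))).
apply: equivariant_eq (equivariant_add (equivariant_add (equivariant_scale (M 0 0) h0)
  (equivariant_scale (M 0 1) h1)) (equivariant_scale (M 1 0) h2)) _.
by move=> f Tf; rewrite weil_VE.
Qed.

Lemma frakA_equivariant D : frakA D -> equivariant D.
Proof.
elim=> {D} [D [[M [M' [_ _ ->]]]|[P hP ->]]||D D' _ hD _ hD'|z D _ hD|D D' _ hD _ hD'].
- exact: equivariant_add (equivariant_weil_su M) (equivariant_weil_V M').
- exact: equivariant_mul.
- exact: equivariant_id.
- exact: equivariant_add.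
- exact: equivariant_scale.
- exact: equivariant_comp.
Qed.

Lemma coinv_vfield gam al be br bi f : one_param gam (umat al be br bi) -> T11 f ->
  K (vfield (xi al be br bi) f).
Proof.
move=> hg Tf; rewrite -[vfield _ f]opprK -scaleN1r; apply: lspanZ; apply: lspan_in.
exists (umat al be br bi), f; split=> //; first exact: umat_uV.
by exists gam => //; rewrite (lie_actE hg) //; exact: T11_smooth.
Qed.

Lemma coinv_rel_gen f : [set Phi | exists L Psi, [/\ uV L, T11 Psi & lie_act L Psi Phi]] f ->
  exists gam al be br bi g, [/\ one_param gam (umat al be br bi), T11 g &
    f = - vfield (xi al be br bi) g].
Proof.
move=> [L [g [/uV_umat[al [be [br [bi ->]]]] Tg [gam hg ->]]]].
exists gam, al, be, br, bi, g; split=> //; rewrite (lie_actE hg) //; exact: T11_smooth.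
Qed.

Lemma coinv_sub_T11 : K `<=` @T11 R.
Proof.
apply: lspan_ind; first exact: T110.
move=> a f g /coinv_rel_gen[gam [al [be [br [bi [h [hg Th ->]]]]]]] Tg.
by apply: T11D => //; apply: T11Z; apply: T11N; exact: T11_vfield.
Qed.

Lemma equivariant_coinv D f : equivariant D -> K f -> K (D f).
Proof.
(* D is known to be linear on [T11] only, so the induction over the span must carry membership in
   [T11] along. *)
move=> [D1 D2 D3] Kf; suff [] : T11 f /\ K (D f) by [].
have D0 : D 0 = 0.
  by have := D2 (-1) 0 0 (T110 R) (T110 R); rewrite scaler0 addr0 scaleN1r addNr.
move: f Kf; apply: lspan_ind => [|a f g /coinv_rel_gen[gam [al [be [br [bi [h [hg Th ->]]]]]]] [Tg KDg]].
  by rewrite D0; split; [exact: T110|exact: lspan0].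
have Tv : T11 (vfield (xi al be br bi) h) by exact: T11_vfield.
split; first by apply: T11D => //; apply: T11Z; exact: T11N.
rewrite scalerN -scaleNr D2 // (D3 gam) //; apply: lspanD => //; apply: lspanZ.
by apply: (coinv_vfield hg); exact: D1.
Qed.

Lemma frakA_acts_on_coinv : acts_on_quot (@frakA R) (@T11 R) K.
Proof.
split=> [|D /frakA_equivariant hD]; first exact: coinv_sub_T11.
by have [h1 h2 _] := hD; split=> // f; exact: equivariant_coinv.
Qed.

End Action.

(** * Complex coordinates and monomials *)

Section Monomials.
Variable R : realType.
Local Notation C := R[i].
Local Notation tsp := (tsp R).
Local Notation fct := (tsp -> C).
Local Notation idx := ('I_3 + 'I_4)%type.
Local Notation K := (@coinv_rel R).
Local Notation psi := (@psi11 R).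
Local Notation crd := (@crd R).
Implicit Types (X Y v w : tsp) (f g P Q : fct) (al be br bi : R) (D : fct -> fct).

Lemma dird_complex (l m : {scalar tsp}) v :
  dird v (fun X => (l X +i* m X)%C) = fun=> (l v +i* m v)%C.
Proof.
apply/funext => X; apply: cderiveE.
exact: is_cderive_complex (is_derive_line l X v) (is_derive_line m X v).
Qed.

Lemma sum_ord3 (V : nmodType) (F : 'I_3 -> V) : \sum_i F i = F 0 + F 1 + F 2%:R.
Proof.
rewrite !big_ord_recl big_ord0 addr0 addrA.
by congr (_ + F _ + F _); exact/val_inj.
Qed.

Lemma sum_ord4 (V : nmodType) (F : 'I_4 -> V) :
  \sum_i F i = F 0 + F 1 + F 2%:R + F 3%:R.
Proof.
rewrite !big_ord_recl big_ord0 addr0 !addrA.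
by congr (_ + F _ + F _ + F _); exact/val_inj.
Qed.

Definition cz (k l : idx) X : C := (crd k X +i* crd l X)%C.
Definition czb (k l : idx) X : C := (crd k X -i* crd l X)%C.

Lemma czE k l : cz k l = fun X => (crd k X)%:C%C + 'i%C * (crd l X)%:C%C.
Proof. by apply/funext => X; apply/eqP; rewrite eq_complex /=; apply/andP; split; apply/eqP; ring. Qed.

Lemma czbE k l : czb k l = fun X => (crd k X)%:C%C + - 'i%C * (crd l X)%:C%C.
Proof. by apply/funext => X; apply/eqP; rewrite eq_complex /=; apply/andP; split; apply/eqP; ring. Qed.

(** An upper bound for the degree, read off an expression, so that uniqueness of the polynomial
    behind a function never arises. Constants have every degree, which makes the filtration
    increasing. *)
Inductive pdeg : nat -> set fct :=
| pdeg_cst n z : pdeg n (fun=> z)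
| pdeg_crd k : pdeg 1 (fun X => (crd k X)%:C%C)
| pdeg_add n P Q of pdeg n P & pdeg n Q : pdeg n (fun X => P X + Q X)
| pdeg_mul m n P Q of pdeg m P & pdeg n Q : pdeg (m + n) (fun X => P X * Q X).

Lemma pdeg_leq m n P : (m <= n)%N -> pdeg m P -> pdeg n P.
Proof.
move=> mn hP; rewrite -(subnK mn) (_ : P = fun X => (fun=> 1) X * P X).
  by apply: pdeg_mul => //; exact: pdeg_cst.
by apply/funext => X; rewrite mul1r.
Qed.

Lemma pdeg_scale n z P : pdeg n P -> pdeg n (fun X => z * P X).
Proof. exact: (@pdeg_mul 0 n _ _ (pdeg_cst 0 z)). Qed.

Lemma pdeg_sum (I : Type) (r : seq I) n (F : I -> fct) :
  (forall i, pdeg n (F i)) -> pdeg n (fun X => \sum_(i <- r) F i X).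
Proof.
move=> hF; elim: r => [|i r IH].
  by rewrite (_ : (fun X => _) = fun=> 0); [exact: pdeg_cst|apply/funext => X; rewrite big_nil].
rewrite (_ : (fun X => _) = fun X => F i X + \sum_(i <- r) F i X); first exact: pdeg_add.
by apply/funext => X; rewrite big_cons.
Qed.

Lemma pdeg_scalar (l : {scalar tsp}) : pdeg 1 (fun X => (l X)%:C%C).
Proof.
rewrite (_ : (fun X => _) = fun X => \sum_k (l (bas R k))%:C%C * (crd k X)%:C%C).
  by apply: pdeg_sum => k; apply: pdeg_scale; exact: pdeg_crd.
apply/funext => X; rewrite scalar_sum rmorph_sum.
by apply: eq_bigr => k _; rewrite rmorphM.
Qed.

Lemma poly_pdeg P : polyfun P -> exists n, pdeg n P.
Proof.
elim=> [z|l|{}P Q _ [m hP] _ [n hQ]|{}P Q _ [m hP] _ [n hQ]].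
- by exists 0; exact: pdeg_cst.
- by exists 1; exact: pdeg_scalar.
- exists (maxn m n); apply: pdeg_add; [apply: pdeg_leq hP|apply: pdeg_leq hQ].
    exact: leq_maxl.
  exact: leq_maxr.
- by exists (m + n)%N; exact: pdeg_mul.
Qed.

Lemma pdeg_poly n P : pdeg n P -> polyfun P.
Proof.
elim=> [m z|k|m {}P Q _ hP _ hQ|m m' {}P Q _ hP _ hQ].
- exact: poly_cst.
- exact: (poly_lin (crd k)).
- exact: poly_add.
- exact: poly_mul.
Qed.

(** A linear field loses one degree by differentiating and regains it from its coefficient; hence in
    the later inductions the term with P differentiated is of lower order. *)
Lemma pdeg_vfield (A : {linear tsp -> tsp}) n P : pdeg n P -> pdeg n (vfield A P).
Proof.
elim=> [m z|k|m {}P Q pP hP pQ hQ|m m' {}P Q pP hP pQ hQ].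
- by rewrite vfield_cst; exact: pdeg_cst.
- rewrite (_ : vfield _ _ = fun X => (crd k (A X))%:C%C).
    exact: (pdeg_scalar (crd k \o A)).
  by apply/funext => X; rewrite /vfield (dird_scalar (crd k)).
- rewrite vfieldD; [exact: pdeg_add|exact: smooth_poly (pdeg_poly pP)|].
  exact: smooth_poly (pdeg_poly pQ).
- rewrite vfieldM; [|exact: smooth_poly (pdeg_poly pP)|exact: smooth_poly (pdeg_poly pQ)].
  by apply: pdeg_add; exact: pdeg_mul.
Qed.

Lemma pdeg_cz k l : pdeg 1 (cz k l).
Proof. by rewrite czE; apply: pdeg_add; [|apply: pdeg_scale]; exact: pdeg_crd. Qed.

Lemma pdeg_czb k l : pdeg 1 (czb k l).
Proof. by rewrite czbE; apply: pdeg_add; [|apply: pdeg_scale]; exact: pdeg_crd. Qed.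

Lemma pdegX m n P : pdeg m P -> pdeg (m * n) (fun X => P X ^+ n).
Proof.
move=> hP; elim: n => [|n IH]; first exact: pdeg_cst.
rewrite mulnS (_ : (fun X => _) = fun X => P X * P X ^+ n); first exact: pdeg_mul.
by apply/funext => X; rewrite exprS.
Qed.

Definition za X : C := (crd (inl 0) X)%:C%C.
Definition zw := cz (inl 1) (inl 2%:R).
Definition zwb := czb (inl 1) (inl 2%:R).
Definition zu := cz (inr 0) (inr 1).
Definition zub := czb (inr 0) (inr 1).
Definition zv := cz (inr 2%:R) (inr 3%:R).
Definition zvb := czb (inr 2%:R) (inr 3%:R).

Lemma vfield_cz A k l : vfield A (cz k l) = cz k l \o A.
Proof. by apply/funext => X; rewrite /vfield (dird_complex (crd k) (crd l)). Qed.

Lemma vfield_czb A k l : vfield A (czb k l) = czb k l \o A.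
Proof.
by apply/funext => X; rewrite /vfield (dird_complex (crd k) (\- crd l)).
Qed.

Lemma vfield_za A : vfield A za = za \o A.
Proof. by apply/funext => X; rewrite /vfield (dird_scalar (crd (inl 0))). Qed.

Section XiCoordinates.
Variables (al be br bi : R) (X : tsp).
Let b : C := (br +i* bi)%C.
Let bc : C := (br -i* bi)%C.
Local Notation xiX := (xi al be br bi X).

Lemma za_xi : za xiX = - 'i%C * (b * zwb X - bc * zw X).
Proof.
rewrite /za /zwb /zw /cz /czb /= su_coordK mxE /=.
by apply/eqP; rewrite eq_complex /=; apply/andP; split; apply/eqP; ring.
Qed.
Lemma zw_xi : zw xiX = 'i%C * (al%:C%C - be%:C%C) * zw X - 2 * 'i%C * b * za X.
Proof.
rewrite /za /zwb /zw /cz /czb /= !su_coordK !mxE /=.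
by apply/eqP; rewrite eq_complex /=; apply/andP; split; apply/eqP; ring.
Qed.
Lemma zwb_xi : zwb xiX = - ('i%C * (al%:C%C - be%:C%C)) * zwb X + 2 * 'i%C * bc * za X.
Proof.
rewrite /za /zwb /zw /cz /czb /= !su_coordK !mxE /=.
by apply/eqP; rewrite eq_complex /=; apply/andP; split; apply/eqP; ring.
Qed.
Lemma zu_xi : zu xiX = 'i%C * al%:C%C * zu X + b * zv X.
Proof.
rewrite /zu /zv /cz /czb /= !V_coordK !mxE /=.
by apply/eqP; rewrite eq_complex /=; apply/andP; split; apply/eqP; ring.
Qed.
Lemma zub_xi : zub xiX = - ('i%C * al%:C%C) * zub X + bc * zvb X.
Proof.
rewrite /zub /zvb /cz /czb /= !V_coordK !mxE /=.
by apply/eqP; rewrite eq_complex /=; apply/andP; split; apply/eqP; ring.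
Qed.
Lemma zv_xi : zv xiX = 'i%C * be%:C%C * zv X + bc * zu X.
Proof.
rewrite /zu /zv /cz /czb /= !V_coordK !mxE /=.
by apply/eqP; rewrite eq_complex /=; apply/andP; split; apply/eqP; ring.
Qed.
Lemma zvb_xi : zvb xiX = - ('i%C * be%:C%C) * zvb X + b * zub X.
Proof.
rewrite /zub /zvb /cz /czb /= !V_coordK !mxE /=.
by apply/eqP; rewrite eq_complex /=; apply/andP; split; apply/eqP; ring.
Qed.

(** [qminus] and [qplus] are the coefficients of b and its conjugate in the logarithmic derivative
    of the Gaussian, up to - pi; their vanishing to leading order gives the two noncompact
    relations. *)
Definition qminus Y : C := - 4 * 'i%C * za Y * zwb Y + 2 * zub Y * zv Y.
Definition qplus Y : C := 4 * 'i%C * za Y * zw Y + 2 * zu Y * zvb Y.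

(** The parameters al and be drop out because the Gaussian is invariant under the diagonal torus. *)
Lemma vfield_xi_psi : vfield (xi al be br bi) psi X =
  - pi%:C%C * (b * qminus X + bc * qplus X) * psi X.
Proof.
rewrite vfield_psi; congr (_ * _).
rewrite big_sumType /= sum_ord3 sum_ord4 /= !su_coordK !V_coordK !mxE /=.
rewrite /qplus /qminus /za /zw /zwb /zu /zub /zv /zvb /cz /czb /=.
apply/eqP; rewrite eq_complex /=; apply/andP; split; apply/eqP; ring.
Qed.

End XiCoordinates.

Definition mono (i j j' k k' l l' : nat) : fct := fun X =>
  za X ^+ i * (zw X ^+ j * zwb X ^+ j') * (zu X ^+ k * zub X ^+ k') *
    (zv X ^+ l * zvb X ^+ l').

Lemma mono_pdeg i j j' k k' l l' :
  pdeg (i + (j + j') + (k + k') + (l + l')) (mono i j j' k k' l l').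
Proof.
have hz k0 l0 n : pdeg n (fun X => cz k0 l0 X ^+ n).
  by rewrite -[X in pdeg X _]mul1n; exact/pdegX/pdeg_cz.
have hb k0 l0 n : pdeg n (fun X => czb k0 l0 X ^+ n).
  by rewrite -[X in pdeg X _]mul1n; exact/pdegX/pdeg_czb.
have ha n : pdeg n (fun X => za X ^+ n).
  by rewrite -[X in pdeg X _]mul1n; exact/pdegX/pdeg_crd.
apply: pdeg_mul; [apply: pdeg_mul; [apply: pdeg_mul; first exact: ha|]|];
  by apply: pdeg_mul; [exact: hz|exact: hb].
Qed.

Inductive mspan (n : nat) : set fct :=
| mspan_mono c i j j' k k' l l' of (i + (j + j') + (k + k') + (l + l') <= n)%N :
    mspan n (fun X => c * mono i j j' k k' l l' X)
| mspan_add P Q of mspan n P & mspan n Q : mspan n (fun X => P X + Q X).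

Lemma mspan_mul m n P Q : mspan m P -> mspan n Q -> mspan (m + n) (fun X => P X * Q X).
Proof.
move=> hP hQ; elim: hP => [c i j j' k k' l l' hm|{}P P' _ IH _ IH'].
  elim: hQ => [d i1 j1 j1' k1 k1' l1 l1' hn|{}Q Q' _ IH _ IH'].
    rewrite (_ : (fun X => _) = fun X => (c * d) *
      mono (i + i1) (j + j1) (j' + j1') (k + k1) (k' + k1') (l + l1) (l' + l1') X).
      by apply: mspan_mono; lia.
    by apply/funext => X; rewrite /mono !exprD; ring.
  rewrite (_ : (fun X => _) = fun X => c * mono i j j' k k' l l' X * Q X +
    c * mono i j j' k k' l l' X * Q' X); first exact: mspan_add.
  by apply/funext => X; rewrite mulrDr.
rewrite (_ : (fun X => _) = fun X => P X * Q X + P' X * Q X); first exact: mspan_add.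
by apply/funext => X; rewrite mulrDl.
Qed.

(** Each real coordinate is a combination of a complex coordinate and its conjugate, with
    coefficients 1/2, 1/2 for a real part and -i/2, i/2 for an imaginary part. *)
Lemma pdeg_mspan n P : pdeg n P -> mspan n P.
Proof.
elim=> {n P} [n z|k|n P Q _ hP _ hQ|m n P Q _ hP _ hQ]; last 2 first.
- exact: mspan_add.
- exact: mspan_mul.
- rewrite (_ : (fun X => _) = fun X => z * mono 0 0 0 0 0 0 0 X); first exact: mspan_mono.
  by apply/funext => X; rewrite /mono !expr0 !mulr1.
have two : (2%:R : C) != 0 by rewrite pnatr_eq0.
have re (k0 l0 : idx) X : (crd k0 X)%:C%C = 2^-1 * cz k0 l0 X + 2^-1 * czb k0 l0 X.
  by rewrite czE czbE; field.
have im (k0 l0 : idx) X : (crd l0 X)%:C%C = (- 'i%C / 2) * cz k0 l0 X + ('i%C / 2) * czb k0 l0 X.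
  rewrite czE czbE; transitivity (- ('i%C * 'i%C) * (crd l0 X)%:C%C); last by field.
  by rewrite -expr2 sqr_i opprK mul1r.
case: k => [[[|[|[|//]]] h]|[[|[|[|[|//]]]] h]].
- rewrite (_ : (fun X => _) = fun X => 1 * mono 1 0 0 0 0 0 0 X); first exact: mspan_mono.
  apply/funext => X; rewrite /mono !expr0 !expr1 !mulr1 mul1r /za.
  by congr (Defs.su_coord _ _)%:C%C; exact/val_inj.
- rewrite (_ : (fun X => _) = fun X => 2^-1 * mono 0 1 0 0 0 0 0 X + 2^-1 * mono 0 0 1 0 0 0 0 X).
    by apply: mspan_add; exact: mspan_mono.
  apply/funext => X; rewrite /mono !expr0 !expr1 !mulr1 !mul1r -re.
  by congr (Defs.su_coord _ _)%:C%C; exact/val_inj.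
- rewrite (_ : (fun X => _) = fun X =>
    (- 'i%C / 2) * mono 0 1 0 0 0 0 0 X + ('i%C / 2) * mono 0 0 1 0 0 0 0 X).
    by apply: mspan_add; exact: mspan_mono.
  apply/funext => X; rewrite /mono !expr0 !expr1 !mulr1 !mul1r -im.
  by congr (Defs.su_coord _ _)%:C%C; exact/val_inj.
- rewrite (_ : (fun X => _) = fun X => 2^-1 * mono 0 0 0 1 0 0 0 X + 2^-1 * mono 0 0 0 0 1 0 0 X).
    by apply: mspan_add; exact: mspan_mono.
  apply/funext => X; rewrite /mono !expr0 !expr1 !mulr1 !mul1r -re.
  by congr (Defs.V_coord _ _)%:C%C; exact/val_inj.
- rewrite (_ : (fun X => _) = fun X =>
    (- 'i%C / 2) * mono 0 0 0 1 0 0 0 X + ('i%C / 2) * mono 0 0 0 0 1 0 0 X).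
    by apply: mspan_add; exact: mspan_mono.
  apply/funext => X; rewrite /mono !expr0 !expr1 !mulr1 !mul1r -im.
  by congr (Defs.V_coord _ _)%:C%C; exact/val_inj.
- rewrite (_ : (fun X => _) = fun X => 2^-1 * mono 0 0 0 0 0 1 0 X + 2^-1 * mono 0 0 0 0 0 0 1 X).
    by apply: mspan_add; exact: mspan_mono.
  apply/funext => X; rewrite /mono !expr0 !expr1 !mulr1 !mul1r -re.
  by congr (Defs.V_coord _ _)%:C%C; exact/val_inj.
- rewrite (_ : (fun X => _) = fun X =>
    (- 'i%C / 2) * mono 0 0 0 0 0 1 0 X + ('i%C / 2) * mono 0 0 0 0 0 0 1 X).
    by apply: mspan_add; exact: mspan_mono.
  apply/funext => X; rewrite /mono !expr0 !expr1 !mulr1 !mul1r -im.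
  by congr (Defs.V_coord _ _)%:C%C; exact/val_inj.
Qed.

End Monomials.

(** * Induction on the degree *)

Section Spanning.
Variable R : realType.
Local Notation C := R[i].
Local Notation tsp := (tsp R).
Local Notation fct := (tsp -> C).
Local Notation idx := ('I_3 + 'I_4)%type.
Local Notation K := (@coinv_rel R).
Local Notation psi := (@psi11 R).
Local Notation crd := (@crd R).
Local Notation za := (@za R).
Local Notation zw := (@zw R).
Local Notation zwb := (@zwb R).
Local Notation zu := (@zu R).
Local Notation zub := (@zub R).
Local Notation zv := (@zv R).
Local Notation zvb := (@zvb R).
Local Notation mono := (@mono R).
Implicit Types (X Y v w : tsp) (f g P Q : fct) (al be br bi : R) (D : fct -> fct).
#[local] Opaque dird.

Lemma pdeg_T11 n P : pdeg n P -> T11 (fun X => P X * psi X).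
Proof. by move=> hP; apply: T11P; exact: pdeg_poly hP. Qed.

Lemma pdeg_smooth n P : pdeg n P -> smooth P.
Proof. by move=> hP; apply: smooth_poly; exact: pdeg_poly hP. Qed.

(* The preimage in T11 of the submodule generated by the class of psi. *)
Definition gen f := T11 f /\ exists2 D, @frakA R D & K (f - D psi).

Lemma gen_psi : gen psi.
Proof.
split; first by exists (fun=> 1); [exact: poly_cst|apply/funext => X; rewrite mul1r].
by exists id; [exact: gen_id|rewrite subrr; exact: lspan0].
Qed.

Lemma gen_coinv f : K f -> gen f.
Proof.
move=> Kf; split; first exact: coinv_sub_T11.
(* The zero operator, as a multiple of the identity. *)
exists (fun f => 0 *: f); first by apply: gen_scale; exact: gen_id.
by rewrite scale0r subr0.
Qed.

Lemma genD f g : gen f -> gen g -> gen (fun X => f X + g X).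
Proof.
move=> [Tf [D hD KD]] [Tg [D' hD' KD']]; split; first exact: T11D.
exists (fun f => D f + D' f); first exact: gen_add.
have -> : (fun X => f X + g X) - (D psi + D' psi) = (f - D psi) + (g - D' psi).
  by rewrite addrACA -opprD.
exact: lspanD.
Qed.

Lemma genZ z f : gen f -> gen (fun X => z * f X).
Proof.
move=> [Tf [D hD KD]]; split; first exact: T11Z.
exists (fun f => z *: D f); first exact: gen_scale.
have -> : (fun X => z * f X) - z *: D psi = z *: (f - D psi) by rewrite scalerBr.
exact: lspanZ.
Qed.

Lemma genB f g : gen f -> gen g -> gen (fun X => f X - g X).
Proof.
move=> hf hg; rewrite (_ : (fun X => _) = fun X => f X + (-1) * g X).
  by apply: genD => //; exact: genZ.
by apply/funext => X; rewrite mulN1r.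
Qed.

Lemma gen_act D f : @frakA R D -> gen f -> gen (D f).
Proof.
move=> hD [Tf [D' hD' KD']]; have [h1 h2 h3] := frakA_equivariant hD.
have [k1 _ _] := frakA_equivariant hD'.
have Tp : T11 psi by case: gen_psi.
split; first exact: h1.
exists (D \o D'); first exact: gen_comp.
have -> : D f - (D \o D') psi = D (f - D' psi).
  have e : f - D' psi = -1 *: D' psi + f by rewrite scaleN1r; exact: addrC.
  by rewrite e (h2 (-1) _ _ (k1 _ Tp) Tf) scaleN1r; exact: addrC.
exact: equivariant_coinv (frakA_equivariant hD) KD'.
Qed.

Lemma frakA_mul P : inv_polyfun P -> @frakA R (fun f X => P X * f X).
Proof. by move=> hP; apply: gen_in; right; exists P. Qed.

Lemma frakA_omega M M' : \tr M = 0 -> \tr M' = 0 -> @frakA R (omega M M').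
Proof. by move=> hM hM'; apply: gen_in; left; exists M, M'. Qed.

Lemma mx2_tr (a b c d : C) : \tr (mx2 a b c d) = a + d.
Proof. by rewrite /mxtrace sum_ord2 !mxE. Qed.

Let weight0 : 'M[C]_2 := mx2 1 0 0 (-1).

Lemma omega_weight_su f : T11 f -> omega weight0 0 f = (3 / 2) *: f + vfield (@proj_su R) f.
Proof.
move=> Tf; rewrite /omega weil_suE // weil_VE // !mxE /=.
by rewrite scale1r !scale0r !addr0.
Qed.

Lemma omega_weight_V f : T11 f -> omega 0 weight0 f = (4 / 2) *: f + vfield (@proj_V R) f.
Proof.
move=> Tf; rewrite /omega weil_suE // weil_VE // !mxE /=.
by rewrite scale1r !scale0r !addr0 add0r.
Qed.

Lemma vfield_proj_su_psi : vfield (@proj_su R) psi =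
  fun X => - (2 * pi%:C%C) * (za X * za X + zw X * zwb X) * psi X.
Proof.
apply/funext => X; rewrite vfield_psi; congr (_ * _).
rewrite big_sumType /= sum_ord3 sum_ord4 /= !su_coordK !V_coordK !mxE.
rewrite /za /zw /zwb /cz /czb /=.
by apply/eqP; rewrite eq_complex /=; apply/andP; split; apply/eqP; ring.
Qed.

Lemma vfield_proj_V_psi : vfield (@proj_V R) psi =
  fun X => - (2 * pi%:C%C) * (zu X * zub X + zv X * zvb X) * psi X.
Proof.
apply/funext => X; rewrite vfield_psi; congr (_ * _).
rewrite big_sumType /= sum_ord3 sum_ord4 /= !su_coordK !V_coordK !mxE.
rewrite /zu /zub /zv /zvb /cz /czb /=.
by apply/eqP; rewrite eq_complex /=; apply/andP; split; apply/eqP; ring.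
Qed.

Lemma Q0_z X : Q0 X = (za X * za X - zw X * zwb X) / 2.
Proof.
rewrite Q0E /za /zw /zwb /cz /czb /=; set s := su_coord 0 X.
have -> : (2 : C) = (2%:R)%:C%C by rewrite rmorph_nat.
rewrite -fmorphV.
by apply/eqP; rewrite eq_complex /=; apply/andP; split; apply/eqP; ring.
Qed.

Lemma Q1_z X : Q1 X = (zu X * zub X - zv X * zvb X) / 2.
Proof.
rewrite Q1E /zu /zub /zv /zvb /cz /czb /=.
have -> : (2 : C) = (2%:R)%:C%C by rewrite rmorph_nat.
rewrite -fmorphV.
by apply/eqP; rewrite eq_complex /=; apply/andP; split; apply/eqP; ring.
Qed.

Lemma pi_neq0C : pi%:C%C != 0 :> C.
Proof. by rewrite (inj_eq (@complexI R)) gt_eqF // pi_gt0. Qed.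

Lemma two_neq0C : 2 != 0 :> C. Proof. by rewrite pnatr_eq0. Qed.

(* Used for an sl_2 triple whose diagonal element D is z plus the Euler field B
   of one summand, where psi is the Gaussian of p + q and Q = (p - q) / 2. *)
Lemma gen_raise (B : {linear tsp -> tsp}) (D : fct -> fct) z (p q : fct) P n :
  @frakA R D -> (forall f, T11 f -> D f = z *: f + vfield B f) ->
  vfield B psi = (fun X => - (2 * pi%:C%C) * (p X + q X) * psi X) ->
  inv_polyfun (fun X => (p X - q X) / 2) ->
  (forall Q, pdeg n Q -> gen (fun X => Q X * psi X)) -> pdeg n P ->
  gen (fun X => p X * P X * psi X) /\ gen (fun X => q X * P X * psi X).
Proof.
move=> hD DE hpsi hpq IH hP.
have gP := IH _ hP; have gB := IH _ (pdeg_vfield B hP).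
have h1 := gen_act (frakA_mul hpq) gP.
have := gen_act hD gP; rewrite DE; last exact: pdeg_T11 hP.
rewrite (vfieldM _ (pdeg_smooth hP) (smooth_psi R)) hpsi => h2.
have h3 := genB (genB h2 (genZ z gP)) gB.
(* [h3] is - 2 pi (p + q) P psi; this factor makes it (p + q) / 2 * P psi, whose sum and difference
   with Q P psi, Q = (p - q) / 2, are p P psi and q P psi. *)
have h4 := genZ (- (4 * pi%:C%C)^-1) h3.
have hpi := pi_neq0C; have h2n := two_neq0C.
split.
  rewrite (_ : (fun X => _) = fun X => - (4 * pi%:C%C)^-1 *
    ((z *: (fun X => P X * psi X) + (fun X => vfield B P X * psi X +
      P X * (- (2 * pi%:C%C) * (p X + q X) * psi X))) X -
      z * (P X * psi X) - vfield B P X * psi X) + (p X - q X) / 2 * (P X * psi X)).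
    exact: genD.
  apply/funext => X; rewrite !fctE /GRing.scale /=.
  move: (P X) (psi X) (vfield B P X) (p X) (q X) (pi%:C%C) hpi => Px s vx px qx c hc.
  by field.
rewrite (_ : (fun X => _) = fun X => - (4 * pi%:C%C)^-1 *
    ((z *: (fun X => P X * psi X) + (fun X => vfield B P X * psi X +
      P X * (- (2 * pi%:C%C) * (p X + q X) * psi X))) X -
      z * (P X * psi X) - vfield B P X * psi X) - (p X - q X) / 2 * (P X * psi X)).
  exact: genB.
apply/funext => X; rewrite !fctE /GRing.scale /=.
move: (P X) (psi X) (vfield B P X) (p X) (q X) (pi%:C%C) hpi => Px s vx px qx c hc.
by field.
Qed.

Lemma gen_raise_su n P : (forall Q, pdeg n Q -> gen (fun X => Q X * psi X)) -> pdeg n P ->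
  gen (fun X => za X * za X * P X * psi X) /\ gen (fun X => zw X * zwb X * P X * psi X).
Proof.
apply: (@gen_raise (@proj_su R) (omega weight0 0) (3 / 2) (fun X => za X * za X)).
- by apply: frakA_omega; rewrite ?mx2_tr ?mxtrace0 ?subrr.
- exact: omega_weight_su.
- exact: vfield_proj_su_psi.
- rewrite (_ : (fun X => _) = @Q0 R); first exact: Q0_inv.
  by apply/funext => X; rewrite Q0_z.
Qed.

Lemma gen_raise_V n P : (forall Q, pdeg n Q -> gen (fun X => Q X * psi X)) -> pdeg n P ->
  gen (fun X => zu X * zub X * P X * psi X) /\ gen (fun X => zv X * zvb X * P X * psi X).
Proof.
apply: (@gen_raise (@proj_V R) (omega 0 weight0) (4 / 2) (fun X => zu X * zub X)).
- by apply: frakA_omega; rewrite ?mx2_tr ?mxtrace0 ?subrr.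
- exact: omega_weight_V.
- exact: vfield_proj_V_psi.
- rewrite (_ : (fun X => _) = @Q1 R); first exact: Q1_inv.
  by apply/funext => X; rewrite Q1_z.
Qed.

(** The field of an off-diagonal L sends P psi to a coinvariant relation; removing the part with P
    differentiated, still of degree n, leaves b [qminus] + conj(b) [qplus] times P psi. *)
Lemma gen_hyperbolic n P : (forall Q, pdeg n Q -> gen (fun X => Q X * psi X)) -> pdeg n P ->
  gen (fun X => qminus X * P X * psi X) /\ gen (fun X => qplus X * P X * psi X).
Proof.
move=> IH hP; have hpi := pi_neq0C; have h2n := two_neq0C.
have hq br bi : br ^+ 2 + bi ^+ 2 = 1 ->
    gen (fun X => ((br +i* bi)%C * qminus X + (br -i* bi)%C * qplus X) * P X * psi X).
  move=> /one_param_hyperbolic[gam hg].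
  have /gen_coinv h1 := coinv_vfield hg (pdeg_T11 hP).
  have h2 := genB (IH _ (pdeg_vfield (xi 0 0 br bi) hP)) h1.
  have h3 := genZ (pi%:C%C)^-1 h2.
  move: h3; congr gen; apply/funext => X.
  rewrite (vfieldM _ (pdeg_smooth hP) (smooth_psi R)) vfield_xi_psi.
  move: (P X) (psi X) (vfield _ P X) (qminus X) (qplus X) (pi%:C%C) hpi => Px s vx px qx c hc.
  by field.
(* b = 1 yields [qminus] + [qplus] and b = i yields i ([qminus] - [qplus]); complex combinations
   separate the two. *)
have /hq h1 : 1 ^+ 2 + 0 ^+ 2 = 1 :> R by rewrite expr1n expr0n addr0.
have /hq h2 : 0 ^+ 2 + 1 ^+ 2 = 1 :> R by rewrite expr1n expr0n add0r.
have e1 : (1 +i* 0)%C = 1 :> C by [].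
have e2 : (1 -i* 0)%C = 1 :> C by rewrite oppr0.
have e3 : (0 -i* 1)%C = - 'i%C :> C by apply/eqP; rewrite eq_complex /= oppr0 !eqxx.
rewrite e1 e2 in h1; rewrite -[(0 +i* 1)%C]/('i%C) e3 in h2.
have ii : 'i%C * 'i%C = -1 :> C by rewrite -expr2 sqr_i.
split.
  have := genZ 2^-1 (genB h1 (genZ 'i%C h2)); congr gen; apply/funext => X.
  transitivity ((2^-1 * (1 - 'i%C * 'i%C) * qminus X + 2^-1 * (1 + 'i%C * 'i%C) * qplus X)
    * (P X * psi X)); first by ring.
  by rewrite ii; field.
have := genZ 2^-1 (genD h1 (genZ 'i%C h2)); congr gen; apply/funext => X.
transitivity ((2^-1 * (1 + 'i%C * 'i%C) * qminus X + 2^-1 * (1 - 'i%C * 'i%C) * qplus X)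
    * (P X * psi X)); first by ring.
by rewrite ii; field.
Qed.

(** * Torus weights of monomials and the degree induction *)

Lemma vfield_eigM A f g lam mu : smooth f -> smooth g ->
  vfield A f = lam *: f -> vfield A g = mu *: g ->
  vfield A (fun X => f X * g X) = (lam + mu) *: (fun X => f X * g X).
Proof.
move=> sf sg hf hg; rewrite vfieldM // hf hg; apply/funext => X.
by rewrite !fctE /GRing.scale /=; ring.
Qed.

Lemma smoothX f n : smooth f -> smooth (fun X => f X ^+ n).
Proof.
move=> sf; elim: n => [|n IH]; first exact: smooth_cst.
rewrite (_ : (fun X => _) = fun X => f X * f X ^+ n); first exact: smoothM.
by apply/funext => X; rewrite exprS.
Qed.

Lemma vfield_eigX A f lam n : smooth f -> vfield A f = lam *: f ->
  vfield A (fun X => f X ^+ n) = (lam *+ n) *: (fun X => f X ^+ n).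
Proof.
move=> sf hf; elim: n => [|n IH].
  by rewrite mulr0n scale0r (_ : (fun X => _) = fun=> 1) // vfield_cst.
rewrite mulrS (_ : (fun X => _) = fun X => f X * f X ^+ n); last first.
  by apply/funext => X; rewrite exprS.
by apply: vfield_eigM => //; exact: smoothX.
Qed.

(** In the parameters (al, be), [zw], [zu], [zv] have weights (1, -1), (1, 0), (0, 1), their
    conjugates the opposite ones, and [za] and [psi] weight zero; weights add in products. *)
Lemma vfield_compact_mono al be i j j' k k' l l' :
  vfield (xi al be 0 0) (fun X => mono i j j' k k' l l' X * psi X) =
  ('i%C * (al%:C%C * ((j + k)%:R - (j' + k')%:R) + be%:C%C * ((j' + l)%:R - (j + l')%:R))) *:
  (fun X => mono i j j' k k' l l' X * psi X).
Proof.
have sz k0 l0 := pdeg_smooth (@pdeg_cz R k0 l0).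
have sb k0 l0 := pdeg_smooth (@pdeg_czb R k0 l0).
have sa : smooth za := @smooth_crd R (inl 0).
have e0 : (0 +i* 0)%C = 0 :> C by [].
have e0' : (0 -i* 0)%C = 0 :> C by rewrite oppr0.
pose xx := xi al be 0 0.
have va : vfield xx za = 0 *: za.
  rewrite vfield_za; apply/funext => X; rewrite /= za_xi e0 e0' scale0r; ring.
have vw : vfield xx zw = ('i%C * (al%:C%C - be%:C%C)) *: zw.
  rewrite (vfield_cz _ _ _ : vfield xx zw = zw \o xx).
  by apply/funext => X; rewrite /= zw_xi e0 !fctE /GRing.scale /=; ring.
have vwb : vfield xx zwb = (- ('i%C * (al%:C%C - be%:C%C))) *: zwb.
  rewrite (vfield_czb _ _ _ : vfield xx zwb = zwb \o xx).
  by apply/funext => X; rewrite /= zwb_xi e0' !fctE /GRing.scale /=; ring.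
have vu : vfield xx zu = ('i%C * al%:C%C) *: zu.
  rewrite (vfield_cz _ _ _ : vfield xx zu = zu \o xx).
  by apply/funext => X; rewrite /= zu_xi e0 !fctE /GRing.scale /=; ring.
have vub : vfield xx zub = (- ('i%C * al%:C%C)) *: zub.
  rewrite (vfield_czb _ _ _ : vfield xx zub = zub \o xx).
  by apply/funext => X; rewrite /= zub_xi e0' !fctE /GRing.scale /=; ring.
have vv : vfield xx zv = ('i%C * be%:C%C) *: zv.
  rewrite (vfield_cz _ _ _ : vfield xx zv = zv \o xx).
  by apply/funext => X; rewrite /= zv_xi e0' !fctE /GRing.scale /=; ring.
have vvb : vfield xx zvb = (- ('i%C * be%:C%C)) *: zvb.
  rewrite (vfield_czb _ _ _ : vfield xx zvb = zvb \o xx).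
  by apply/funext => X; rewrite /= zvb_xi e0 !fctE /GRing.scale /=; ring.
have vpsi : vfield xx psi = 0 *: psi.
  by apply/funext => X; rewrite vfield_xi_psi e0 e0' scale0r; ring.
have M f g lam mu : smooth f /\ vfield xx f = lam *: f -> smooth g /\ vfield xx g = mu *: g ->
    smooth (fun X => f X * g X) /\
    vfield xx (fun X => f X * g X) = (lam + mu) *: (fun X => f X * g X).
  by move=> [? ?] [? ?]; split; [exact: smoothM|exact: vfield_eigM].
have E f lam n : smooth f -> vfield xx f = lam *: f ->
    smooth (fun X => f X ^+ n) /\ vfield xx (fun X => f X ^+ n) = (lam *+ n) *: (fun X => f X ^+ n).
  by move=> ? ?; split; [exact: smoothX|exact: vfield_eigX].
have [_ ->] := M _ _ _ _ (M _ _ _ _ (M _ _ _ _ (M _ _ _ _ (E _ _ i sa va)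
  (M _ _ _ _ (E _ _ j (sz _ _) vw) (E _ _ j' (sb _ _) vwb)))
  (M _ _ _ _ (E _ _ k (sz _ _) vu) (E _ _ k' (sb _ _) vub)))
  (M _ _ _ _ (E _ _ l (sz _ _) vv) (E _ _ l' (sb _ _) vvb))) (conj (smooth_psi R) vpsi).
apply: (congr1 (fun z : C => z *: (fun X => mono i j j' k k' l l' X * psi X))).
by rewrite !natrD mul0rn !mulNrn -!(mulr_natr (_ * _)); ring.
Qed.

(** Some torus direction has a nonzero eigenvalue on the monomial, so the monomial times [psi] is
    itself a multiple of a coinvariant relation. *)
Lemma gen_mono_weight i j j' k k' l l' : (j + k != j' + k')%N || (j' + l != j + l')%N ->
  gen (fun X => mono i j j' k k' l l' X * psi X).
Proof.
move=> hw.
have [al [be hlam]] : exists al be, 'i%C * (al%:C%C * ((j + k)%:R - (j' + k')%:R) +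
    be%:C%C * ((j' + l)%:R - (j + l')%:R)) != 0 :> C.
  have i0 : 'i%C != 0 :> C by rewrite eq_complex /= oner_eq0 andbF.
  case/orP: hw => hw; [exists 1, 0|exists 0, 1].
    by rewrite mul1r mul0r addr0 mulf_neq0 // subr_eq0 eqr_nat.
  by rewrite mul1r mul0r add0r mulf_neq0 // subr_eq0 eqr_nat.
set lam := 'i%C * _ in hlam.
have [gam hg] := one_param_compact al be.
have /gen_coinv := coinv_vfield hg (pdeg_T11 (mono_pdeg R i j j' k k' l l')).
rewrite vfield_compact_mono -/lam => /(genZ lam^-1); congr gen; apply/funext => X.
by rewrite !fctE /GRing.scale /= mulrA mulVf // mul1r.
Qed.

Lemma gen_mspan n P : mspan n P ->
  (forall i j j' k k' l l', (i + (j + j') + (k + k') + (l + l') <= n)%N ->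
    gen (fun X => mono i j j' k k' l l' X * psi X)) ->
  gen (fun X => P X * psi X).
Proof.
move=> hP hm; elim: hP => [c i j j' k k' l l' hd|{}P Q _ IH _ IH'].
  have := genZ c (hm _ _ _ _ _ _ _ hd); congr gen; apply/funext => X; exact: mulrA.
have := genD IH IH'; congr gen; apply/funext => X; by rewrite mulrDl.
Qed.

Lemma gen_pdeg : gen (fun X => za X * psi X) ->
  forall n P, pdeg n P -> gen (fun X => P X * psi X).
Proof.
move=> ga n; elim/ltn_ind: n => n IH P /pdeg_mspan hP; apply: gen_mspan hP _ => i j j' k k' l l' hd.
have two := two_neq0C.
have IH2 m : (m + 2 <= n)%N -> forall Q, pdeg m Q -> gen (fun X => Q X * psi X).
  by move=> hm; apply: IH; lia.
have ext f g : f =1 g -> gen f -> gen g by move=> /funext ->.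
(* [rW], [rA] and [rB] treat a monomial containing a conjugate pair: it is |w|^2, |u|^2 or |v|^2
   times a monomial of degree at most n - 2. *)
have rW a j0 j1 k0 k1 l0 l1 : (a + (j0.+1 + j1.+1) + (k0 + k1) + (l0 + l1) <= n)%N ->
    gen (fun X => mono a j0.+1 j1.+1 k0 k1 l0 l1 X * psi X).
  move=> hm; have hm2 : (a + (j0 + j1) + (k0 + k1) + (l0 + l1) + 2 <= n)%N by lia.
  have [_ h] := gen_raise_su (IH2 _ hm2) (mono_pdeg R a j0 j1 k0 k1 l0 l1).
  by apply: ext h => X; rewrite /mono !exprS; ring.
have rA a j0 j1 k0 k1 l0 l1 : (a + (j0 + j1) + (k0.+1 + k1.+1) + (l0 + l1) <= n)%N ->
    gen (fun X => mono a j0 j1 k0.+1 k1.+1 l0 l1 X * psi X).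
  move=> hm; have hm2 : (a + (j0 + j1) + (k0 + k1) + (l0 + l1) + 2 <= n)%N by lia.
  have [h _] := gen_raise_V (IH2 _ hm2) (mono_pdeg R a j0 j1 k0 k1 l0 l1).
  by apply: ext h => X; rewrite /mono !exprS; ring.
have rB a j0 j1 k0 k1 l0 l1 : (a + (j0 + j1) + (k0 + k1) + (l0.+1 + l1.+1) <= n)%N ->
    gen (fun X => mono a j0 j1 k0 k1 l0.+1 l1.+1 X * psi X).
  move=> hm; have hm2 : (a + (j0 + j1) + (k0 + k1) + (l0 + l1) + 2 <= n)%N by lia.
  have [_ h] := gen_raise_V (IH2 _ hm2) (mono_pdeg R a j0 j1 k0 k1 l0 l1).
  by apply: ext h => X; rewrite /mono !exprS; ring.
have [hw|] := boolP ((j + k != j' + k')%N || (j' + l != j + l')%N).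
  exact: gen_mono_weight.
rewrite negb_or !negbK => /andP[/eqP e1 /eqP e2].
case: j j' hd e1 e2 => [|j] [|j'] hd e1 e2; last exact: rW.
- have ek : k = k' by lia.
  have el : l = l' by lia.
  subst k l.
  case: k' hd {e1} => [|k'] hd; last exact: rA.
  case: l' hd {e2} => [|l'] hd; last exact: rB.
  case: i hd => [|[|i]] hd.
  + by apply: ext gen_psi => X; rewrite /mono !expr0 !mul1r.
  + by apply: ext ga => X; rewrite /mono !expr0 !expr1 !mulr1.
  + have hm : (i + (0 + 0) + (0 + 0) + (0 + 0) + 2 <= n)%N by lia.
    have [h _] := gen_raise_su (IH2 _ hm) (mono_pdeg R i 0 0 0 0 0 0).
    by apply: ext h => X; rewrite /mono !exprS; ring.
(* Only [zwb] occurs. Zero weight forces [zu] and [zvb] to occur as well, so a factor [zub] or [zv]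
   would complete a pair; otherwise the three exponents coincide. *)
- case: k' e1 hd => [|k'] e1 hd; last first.
    by case: k e1 hd => [|k] e1 hd; [lia|exact: rA].
  case: l e2 hd => [|l] e2 hd; last first.
    by case: l' e2 hd => [|l'] e2 hd; [lia|exact: rB].
  have -> : k = j'.+1 by lia.
  have -> : l' = j'.+1 by lia.
  have hm : (i + (0 + j'.+1) + (j' + 0) + (0 + j') + 2 <= n)%N by lia.
  have [_ h1] := gen_hyperbolic (IH2 _ hm) (mono_pdeg R i 0 j'.+1 j' 0 0 j').
  (* This has the same degree as the original monomial, but one [zu * zvb] has become [za * zw], and
     [zw] pairs with [zwb]. *)
  have h2 : gen (fun X => mono i.+1 1 j'.+1 j' 0 0 j' X * psi X) by apply: rW; lia.
  apply: ext (genZ 2^-1 (genB h1 (genZ (4 * 'i%C) h2))) => X.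
  rewrite /mono /qplus !exprS.
  move: (zw X) (zwb X) (zu X) (zub X) (zv X) (zvb X) (za X) (psi X) => w wb u ub v vb a s.
  by field.
(* The conjugate case, with [qminus] in place of [qplus]. *)
- case: k e1 hd => [|k] e1 hd; last first.
    by case: k' e1 hd => [|k'] e1 hd; [lia|exact: rA].
  case: l' e2 hd => [|l'] e2 hd; last first.
    by case: l e2 hd => [|l] e2 hd; [lia|exact: rB].
  have -> : k' = j.+1 by lia.
  have -> : l = j.+1 by lia.
  have hm : (i + (j.+1 + 0) + (0 + j) + (j + 0) + 2 <= n)%N by lia.
  have [h1 _] := gen_hyperbolic (IH2 _ hm) (mono_pdeg R i j.+1 0 0 j j 0).
  have h2 : gen (fun X => mono i.+1 j.+1 1 0 j j 0 X * psi X) by apply: rW; lia.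
  apply: ext (genZ 2^-1 (genD h1 (genZ (4 * 'i%C) h2))) => X.
  rewrite /mono /qminus !exprS.
  move: (zw X) (zwb X) (zu X) (zub X) (zv X) (zvb X) (za X) (psi X) => w wb u ub v vb a s.
  by field.
Qed.

End Spanning.

(** * The monomial of degree one *)

Section FirstDegree.
Variable R : realType.
Local Notation C := R[i].
Local Notation tsp := (tsp R).
Local Notation fct := (tsp -> C).
Local Notation idx := ('I_3 + 'I_4)%type.
Local Notation psi := (@psi11 R).
Local Notation crd := (@crd R).
Local Notation bas := (@bas R).
Local Notation gen := (@gen R).
Implicit Types (X : tsp) (f P : fct) (e : idx -> R) (k : idx).
#[local] Opaque dird.

Definition sEuler e f : fct :=
  fun X => \sum_k (e k * crd k X)%:C%C * dird (bas k) f X.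

(* The action on P of the compact element (4 pi / i) (f - e) of sl_2, conjugated
   by psi; the quadratic multiples of P contributed by e and f cancel. *)
Definition kappa e P : fct := fun X =>
  laplace e P X - 4 * pi%:C%C * sEuler e P X - 2 * pi%:C%C * (\sum_k e k)%:C%C * P X.

Lemma dird2_psi k P X : polyfun P ->
  dird (bas k) (dird (bas k) (fun X => P X * psi X)) X =
  (dird (bas k) (dird (bas k) P) X
   - 4 * pi%:C%C * ((crd k X)%:C%C * dird (bas k) P X)
   - 2 * pi%:C%C * P X + 4 * pi%:C%C ^+ 2 * ((crd k X)%:C%C ^+ 2 * P X)) * psi X.
Proof.
move=> pP; have sP := smooth_poly pP; have sk := @smooth_crd R k.
have sdP := smooth_dird (bas k) sP; have sp := smooth_psi R.
pose c : C := - (2 * pi%:C%C).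
have sc := @smooth_cst R c.
have dpsi : dird (bas k) psi = fun X => c * (crd k X)%:C%C * psi X.
  apply/funext => Y; rewrite dird_psi; congr (_ * _).
  rewrite (bigD1 k) // [crd k (bas k)]crd_bas eqxx mul1r big1 ?addr0 => [|j jk]; last first.
    by rewrite crd_bas (negPf jk) mul0r.
  by rewrite /= addr0 rmorphM rmorphN rmorphM rmorph_nat.
have dk : dird (bas k) (fun X => (crd k X)%:C%C) = fun=> 1.
  by rewrite (dird_scalar (crd k)) /= crd_bas eqxx.
have sck : smooth (fun X => c * (crd k X)%:C%C) by exact: smoothM.
have sckp := smoothM sck sp.
rewrite (dirdM _ sP sp) dpsi (dirdD _ (smoothM sdP sp) (smoothM sP sckp)).
rewrite (dirdM _ sdP sp) (dirdM _ sP sckp) (dirdM _ sck sp) (dirdM _ sc sk) dpsi dk.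
rewrite dird_cst /c.
move: (dird (bas k) (dird (bas k) P) X) (dird (bas k) P X) (P X) (psi X) (pi%:C%C)
  ((crd k X)%:C%C) => d2 d1 p s q x; ring.
Qed.

Lemma laplace_psi e P : polyfun P ->
  laplace e (fun X => P X * psi X) = fun X =>
  (kappa e P X + 4 * pi%:C%C ^+ 2 * (\sum_k e k * crd k X ^+ 2)%:C%C * P X) * psi X.
Proof.
move=> pP; apply/funext => X; rewrite laplaceE.
transitivity (\sum_k ((e k)%:C%C * dird (bas k) (dird (bas k) P) X
   - 4 * pi%:C%C * ((e k * crd k X)%:C%C * dird (bas k) P X)
   - 2 * pi%:C%C * (e k)%:C%C * P X
   + 4 * pi%:C%C ^+ 2 * (e k * crd k X ^+ 2)%:C%C * P X) * psi X).
  apply: eq_bigr => k _; rewrite dird2_psi // !rmorphM ?rmorphXn /=.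
  move: (dird (bas k) (dird (bas k) P) X) (dird (bas k) P X) (P X) (psi X) (pi%:C%C)
    ((crd k X)%:C%C) ((e k)%:C%C) => d2 d1 p s q x ek; ring.
rewrite -mulr_suml !big_split /= !sumrN; congr ((_ - _ - _ + _) * _).
- by rewrite laplaceE.
- by rewrite -mulr_sumr.
- by rewrite -mulr_suml -mulr_sumr rmorph_sum.
- by rewrite -mulr_suml -mulr_sumr rmorph_sum.
Qed.

Let lower : 'M[C]_2 := mx2 0 0 1 0.

Lemma scale_laplace_neq0 : 'i%C / (4 * pi%:C%C) != 0 :> C.
Proof.
rewrite mulf_neq0 ?invr_eq0 ?mulf_neq0 ?pi_neq0C ?pnatr_eq0 //.
by rewrite eq_complex /= oner_eq0 andbF.
Qed.

Lemma gen_laplace_su f : gen f -> gen (laplace (@sig_su R) f).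
Proof.
move=> gf; have [Tf _] := gf.
have : gen (omega lower 0 f).
  by apply: gen_act => //; apply: frakA_omega; rewrite ?mx2_tr ?mxtrace0 ?addr0.
rewrite /omega weil_suE // weil_VE // !mxE /= !scale0r !scale1r !add0r !addr0.
move=> /(genZ ('i%C / (4 * pi%:C%C))^-1); congr gen; apply/funext => X.
by rewrite [(_ *: _) X]/GRing.scale /= mulKf // scale_laplace_neq0.
Qed.

Lemma gen_laplace_V f : gen f -> gen (laplace (@sig_V R) f).
Proof.
move=> gf; have [Tf _] := gf.
have : gen (omega 0 lower f).
  by apply: gen_act => //; apply: frakA_omega; rewrite ?mx2_tr ?mxtrace0 ?addr0.
rewrite /omega weil_suE // weil_VE // !mxE /= !scale0r !scale1r !add0r.
move=> /(genZ ('i%C / (4 * pi%:C%C))^-1); congr gen; apply/funext => X.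
by rewrite [(_ *: _) X]/GRing.scale /= mulKf // scale_laplace_neq0.
Qed.

(** Conjugation by the Gaussian adds 4 pi^2 times the form sum e_k crd_k^2 = 2 Q to the Laplacian;
    subtracting 8 pi^2 Q, which is multiplication by an invariant, leaves [kappa], an operator that
    does not raise the degree. *)
Lemma gen_kappa e Q P : inv_polyfun Q ->
  (forall X, (\sum_k e k * crd k X ^+ 2)%:C%C = 2 * Q X) ->
  (forall f, gen f -> gen (laplace e f)) ->
  polyfun P -> gen (fun X => P X * psi X) -> gen (fun X => kappa e P X * psi X).
Proof.
move=> hQ QE hl pP gP.
have := genB (hl _ gP) (genZ (8 * pi%:C%C ^+ 2) (gen_act (frakA_mul hQ) gP)).
rewrite laplace_psi //; congr gen; apply/funext => X; rewrite QE.
by move: (kappa e P X) (P X) (psi X) (Q X) (pi%:C%C) => a b c d p; ring.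
Qed.

Lemma gen_kappa_su P : polyfun P -> gen (fun X => P X * psi X) ->
  gen (fun X => kappa (@sig_su R) P X * psi X).
Proof.
apply: gen_kappa (Q0_inv R) _ gen_laplace_su => X.
rewrite Q0E big_sumType /= sum_ord3 sum_ord4 /= !mul0r !addr0.
have -> : (2 : C) = (2%:R)%:C%C by rewrite rmorph_nat.
by rewrite -rmorphM; congr (_%:C)%C; field.
Qed.

Lemma gen_kappa_V P : polyfun P -> gen (fun X => P X * psi X) ->
  gen (fun X => kappa (@sig_V R) P X * psi X).
Proof.
apply: gen_kappa (Q1_inv R) _ gen_laplace_V => X.
rewrite Q1E big_sumType /= sum_ord3 sum_ord4 /= !mul0r !addr0.
have -> : (2 : C) = (2%:R)%:C%C by rewrite rmorph_nat.
by rewrite -rmorphM; congr (_%:C)%C; field.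
Qed.

(** The sum is linear in x with coefficients constant along su(V): the Laplacian kills it, the
    signed Euler field multiplies the j-th term by its sign, and the signs sum to -1. *)
Lemma kappa_su_linear (m : 'I_3 -> fct) : (forall j, polyfun (m j)) ->
  (forall i j, dird (bas (inl i)) (m j) = fun=> 0) ->
  kappa (@sig_su R) (fun X => \sum_j (crd (inl j) X)%:C%C * m j X) =
  fun X => \sum_j (2 * pi%:C%C * (1 - 2 * (sig_su R (inl j))%:C%C)) * ((crd (inl j) X)%:C%C * m j X).
Proof.
move=> pm dm; set P := fun X => \sum_j _.
have sm j := smooth_poly (pm j); have sc (j : 'I_3) := @smooth_crd R (inl j).
have dP i : dird (bas (inl i)) P = m i.
  rewrite /P dird_bigsum => [|j]; last exact: smoothM.
  have dcm (j : 'I_3) Y : dird (bas (inl i)) (fun X => (crd (inl j) X)%:C%C * m j X) Y =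
      (j == i)%:R * m j Y.
    rewrite dirdM // (dird_scalar (crd (inl j))) dm mulr0 addr0; congr (_ * _).
    transitivity (((j == i)%:R : R)%:C%C); last exact: rmorph_nat.
    by congr (_%:C)%C; exact: crd_bas.
  apply/funext => X; rewrite (bigD1 i) // dcm eqxx mul1r big1 /= ?addr0 // => j ji.
  by rewrite dcm (negPf ji) mul0r.
have e1 X : laplace (@sig_su R) P X = 0.
  rewrite laplaceE big_sumType /= !big1 ?addr0 // => i _; first by rewrite mul0r.
  by rewrite dP dm mulr0.
have e2 X : sEuler (@sig_su R) P X =
    \sum_j (sig_su R (inl j))%:C%C * ((crd (inl j) X)%:C%C * m j X).
  rewrite /sEuler big_sumType /= [X in _ + X]big1 ?addr0 => [|i _]; last first.
    by rewrite mul0r mul0r.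
  by apply: eq_bigr => j _; rewrite dP rmorphM mulrA.
have e3 : \sum_k sig_su R k = -1.
  by rewrite big_sumType /= [X in _ + X]big1 // addr0 sum_ord3 /=; ring.
apply/funext => X; rewrite /kappa e1 e2 e3 /P !mulr_sumr sub0r -!sumrN -big_split.
by apply: eq_bigr => j _; rewrite rmorphN rmorph1 /=; ring.
Qed.

Definition uquad (w : 'I_4 -> R) : fct := fun X =>
  \sum_j (w j)%:C%C * ((crd (inr j) X)%:C%C * (crd (inr j) X)%:C%C).

Lemma uquad_poly w : polyfun (uquad w).
Proof.
apply: poly_sum => j; apply: poly_mul; first exact: poly_cst.
by apply: poly_mul; exact: (poly_lin (crd (inr j))).
Qed.

Lemma dird_uquad w i : dird (bas (inr i)) (uquad w) =
  fun X => 2 * (w i)%:C%C * (crd (inr i) X)%:C%C.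
Proof.
have sc (j : 'I_4) := @smooth_crd R (inr j).
have dj (j : 'I_4) Y : dird (bas (inr i))
    (fun X => (w j)%:C%C * ((crd (inr j) X)%:C%C * (crd (inr j) X)%:C%C)) Y =
    (j == i)%:R * (2 * (w j)%:C%C * (crd (inr j) Y)%:C%C).
  rewrite dirdM; [|exact: smooth_cst|exact: smoothM].
  rewrite dird_cst mul0r add0r dirdM // (dird_scalar (crd (inr j))).
  have -> : (crd (inr j) (bas (inr i)))%:C%C = (j == i)%:R.
    transitivity (((j == i)%:R : R)%:C%C); last exact: rmorph_nat.
    by congr (_%:C)%C; exact: crd_bas.
  by ring.
rewrite /uquad dird_bigsum => [|j]; last first.
  by apply: smoothM; [exact: smooth_cst|exact: smoothM].
apply/funext => X; rewrite (bigD1 i) // dj eqxx mul1r big1 /= ?addr0 // => j ji.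
by rewrite dj (negPf ji) mul0r.
Qed.

(** Signature (2,2) has trace zero, so the constant term of [kappa] vanishes; the Laplacian lowers
    the quadratic form to its signed trace, and the Euler field twists its coefficients by the
    signs. *)
Lemma kappa_V_za w : kappa (@sig_V R) (fun X => za X * uquad w X) = fun X =>
  2 * (\sum_j sig_V R (inr j) * w j)%:C%C * za X
  - 8 * pi%:C%C * (za X * uquad (fun j => sig_V R (inr j) * w j) X).
Proof.
set P := fun X => za X * uquad w X.
have sa : smooth (@za R) := @smooth_crd R (inl 0).
have sq := smooth_poly (uquad_poly w); have sc (j : 'I_4) := @smooth_crd R (inr j).
have da i : dird (bas (inr i)) (@za R) = fun=> 0.
  rewrite /za (dird_scalar (crd (inl 0))); apply/funext => X.
  by transitivity ((0 : R)%:C%C) => //; congr (_%:C)%C; exact: crd_bas.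
have dP i : dird (bas (inr i)) P = fun X => za X * (2 * (w i)%:C%C * (crd (inr i) X)%:C%C).
  by rewrite dirdM // da dird_uquad; apply/funext => X; rewrite mul0r add0r.
have ddP i : dird (bas (inr i)) (dird (bas (inr i)) P) = fun X => 2 * (w i)%:C%C * za X.
  have scc := smoothM (@smooth_cst R (2 * (w i)%:C%C)) (sc i).
  rewrite dP dirdM // da dirdM //; last exact: smooth_cst.
  rewrite dird_cst (dird_scalar (crd (inr i))); apply/funext => X.
  have -> : (crd (inr i) (bas (inr i)))%:C%C = 1.
    by transitivity ((1 : R)%:C%C) => //; congr (_%:C)%C; rewrite crd_bas eqxx.
  by ring.
have e1 X : laplace (@sig_V R) P X = 2 * (\sum_j sig_V R (inr j) * w j)%:C%C * za X.
  rewrite laplaceE big_sumType /= [X in X + _]big1 ?add0r => [|i _]; last by rewrite mul0r.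
  rewrite rmorph_sum mulr_sumr mulr_suml; apply: eq_bigr => j _.
  by rewrite ddP rmorphM; ring.
have e2 X : sEuler (@sig_V R) P X = 2 * (za X * uquad (fun j => sig_V R (inr j) * w j) X).
  rewrite /sEuler big_sumType /= [X in X + _]big1 ?add0r => [|i _]; last first.
    by rewrite mul0r mul0r.
  rewrite /uquad !mulr_sumr; apply: eq_bigr => j _.
  by rewrite dP !rmorphM; ring.
have e3 : \sum_k sig_V R k = 0.
  by rewrite big_sumType /= [X in X + _]big1 // add0r sum_ord4 /=; ring.
apply/funext => X; rewrite /kappa e1 e2 e3.
by move: (za X) (uquad _ X) => a q; rewrite rmorph0; ring.
Qed.

(* 8 (u, x u) / i *)
Definition cubic : fct := fun X => - 8 * 'i%C * hform (upart X) (xpart X *m upart X).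

(** The coefficient of the j-th coordinate of x in [cubic]. That of [za] is the positive definite
    form on V, although (u, u) itself is indefinite. *)
Definition cubic_coef (j : 'I_3) : fct :=
  let d j X := (crd (inr j) X)%:C%C in
  match val j with
  | 0 => uquad (fun=> 1)
  | 1 => fun X => 2 * (d 0 X * d 3%:R X + - 1 * (d 1 X * d 2%:R X))
  | _ => fun X => 2 * (d 0 X * d 2%:R X + d 1 X * d 3%:R X)
  end.

Lemma cubicE : cubic = fun X => \sum_j (crd (inl j) X)%:C%C * cubic_coef j X.
Proof.
apply/funext => X; rewrite sum_ord3 /cubic_coef /= /uquad sum_ord4 /=.
have [h11 h00 h10] := suV_entries X.
rewrite /cubic /hform !mxE !sum_ord2 /su_coord /V_coord /= h11 h10.
case: (xpart X 0 0) h00 => a b /= ->.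
case: (xpart X 0 1) (upart X 0 0) (upart X 1 0) => [c d] [p q] [r s] /=.
by apply/eqP; rewrite eq_complex /=; apply/andP; split; apply/eqP; ring.
Qed.

Lemma cubic_coef_poly j : polyfun (cubic_coef j).
Proof.
have pc (k : 'I_4) : polyfun (fun X => (V_coord k X)%:C%C) := poly_lin (crd (inr k)).
case: j => [[|[|[|//]]] ?]; rewrite /cubic_coef /=; first exact: uquad_poly.
  by do ?[exact: poly_cst|exact: pc|apply: poly_add|apply: poly_mul].
by do ?[exact: poly_cst|exact: pc|apply: poly_add|apply: poly_mul].
Qed.

Lemma dird_su_cubic_coef i j : dird (bas (inl i)) (cubic_coef j) = fun=> 0.
Proof.
pose flat f := smooth f /\ dird (bas (inl i)) f = fun=> 0.
have fc z : flat (fun=> z) by split; [exact: smooth_cst|exact: dird_cst].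
have fd (k : 'I_4) : flat (fun X => (V_coord k X)%:C%C).
  split; first exact: (@smooth_crd R (inr k)).
  rewrite (dird_scalar (crd (inr k))); apply/funext => X.
  by transitivity ((0 : R)%:C%C) => //; congr (_%:C)%C; exact: crd_bas.
have fD f g : flat f -> flat g -> flat (fun X => f X + g X).
  move=> [sf df] [sg dg]; split; first exact: smoothD.
  by rewrite dirdD // df dg; apply/funext => X; rewrite addr0.
have fM f g : flat f -> flat g -> flat (fun X => f X * g X).
  move=> [sf df] [sg dg]; split; first exact: smoothM.
  by rewrite dirdM // df dg; apply/funext => X; rewrite mul0r mulr0 addr0.
suff [] : flat (cubic_coef j) by [].
case: j => [[|[|[|//]]] ?]; rewrite /cubic_coef /=; last 2 first.
- exact: (fM _ _ (fc 2) (fD _ _ (fM _ _ (fd 0) (fd 3%:R))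
    (fM _ _ (fc (- 1)) (fM _ _ (fd 1) (fd 2%:R))))).
- exact: (fM _ _ (fc 2) (fD _ _ (fM _ _ (fd 0) (fd 2%:R)) (fM _ _ (fd 1) (fd 3%:R)))).
rewrite (_ : uquad _ = fun X =>
  (crd (inr 0) X)%:C%C * (crd (inr 0) X)%:C%C + (crd (inr 1) X)%:C%C * (crd (inr 1) X)%:C%C +
  (crd (inr 2%:R) X)%:C%C * (crd (inr 2%:R) X)%:C%C +
  (crd (inr 3%:R) X)%:C%C * (crd (inr 3%:R) X)%:C%C).
  exact: (fD _ _ (fD _ _ (fD _ _ (fM _ _ (fd 0) (fd 0)) (fM _ _ (fd 1) (fd 1)))
    (fM _ _ (fd 2%:R) (fd 2%:R))) (fM _ _ (fd 3%:R) (fd 3%:R))).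
by apply/funext => X; rewrite /uquad sum_ord4 !mul1r.
Qed.

Lemma cubic_inv : inv_polyfun cubic.
Proof.
split.
  rewrite cubicE; apply: poly_sum => j; apply: poly_mul; last exact: cubic_coef_poly.
  exact: (poly_lin (crd (inl j))).
move=> g; apply/funext => X; rewrite /fun_act /cubic /upart /xpart /=; congr (_ * _).
have [hU hh] := UVinv_subproof g.
by rewrite -[RHS]hh -!mulmxA (mulKmx hU).
Qed.

Lemma gen_za : gen (fun X => za X * psi X).
Proof.
have pa w : polyfun (fun X => za X * uquad w X).
  by apply: poly_mul; [exact: (poly_lin (crd (inl 0)))|exact: uquad_poly].
have hpi := pi_neq0C R.
have h0 := gen_act (frakA_mul cubic_inv) (gen_psi R).
have h1 : gen (fun X => za X * uquad (fun=> 1) X * psi X).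
  have h := gen_kappa_su (proj1 cubic_inv) h0.
  have e := kappa_su_linear cubic_coef_poly dird_su_cubic_coef.
  rewrite -cubicE in e; rewrite e in h.
  (* [kappa] has eigenvalue - 2 pi on the term with [za] and 6 pi on the other two. Subtracting 6 pi
     kills those two and leaves - 8 pi times the first. *)
  have {h} := genZ (- (8 * pi%:C%C)^-1) (genB h (genZ (6 * pi%:C%C) h0)).
  congr gen; apply/funext => X; rewrite cubicE !sum_ord3.
  have [s0 s1 s2] : [/\ sig_su R (inl 0) = 1, sig_su R (inl 1) = -1 &
    sig_su R (inl 2%:R) = -1] by [].
  rewrite s0 s1 s2 rmorphN rmorph1 -[uquad (fun=> 1) X]/(cubic_coef 0 X).
  rewrite -[za X]/((crd (inl 0) X)%:C%C).
  move: (cubic_coef 0 X) (cubic_coef 1 X) (cubic_coef 2%:R X) ((crd (inl 0) X)%:C%C)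
    ((crd (inl 1) X)%:C%C) ((crd (inl 2%:R) X)%:C%C) (psi X) (pi%:C%C) hpi.
  by move=> m0 m1 m2 c0 c1 c2 s p hp; field.
pose sg (j : 'I_4) := sig_V R (inr j).
(* The first application of [kappa] to the definite form has no constant term, as the signs sum to
   zero, and turns the form into the one with coefficients [sg]. *)
have h2 : gen (fun X => za X * uquad (fun j => sg j * 1) X * psi X).
  have h := gen_kappa_V (pa _) h1; rewrite kappa_V_za in h.
  have := genZ (- (8 * pi%:C%C)^-1) h; congr gen; apply/funext => X.
  have -> : \sum_j sig_V R (inr j) * 1 = 0 by rewrite sum_ord4 /=; ring.
  rewrite rmorph0 -/sg.
  by move: (za X) (uquad _ X) (psi X) (pi%:C%C) hpi => a q s p hp; field.
have h := gen_kappa_V (pa _) h2; rewrite kappa_V_za in h.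
(* The second application returns to the definite form, since the signs square to 1, and now
   contributes the trace 4, giving 8 [za] minus 8 pi times the function of [h1]. Adding that
   function back leaves 8 [za]. *)
have := genZ 8^-1 (genD h (genZ (8 * pi%:C%C) h1)); congr gen; apply/funext => X.
have -> : \sum_j sig_V R (inr j) * (sg j * 1) = 4.
  by rewrite /sg sum_ord4 /=; ring.
have -> : (fun j => sig_V R (inr j) * (sg j * 1)) = (fun=> 1).
  by apply/funext => -[[|[|[|[|//]]]] ?]; rewrite /sg /=; ring.
rewrite rmorph_nat.
by move: (za X) (uquad _ X) (psi X) (pi%:C%C) hpi => a q s p hp; field.
Qed.

End FirstDegree.

Theorem theorem7p2 (R : realType) :
  cyclic_quot (@frakA R) (@T11 R) (@coinv_rel R) (@psi11 R).
Proof.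
split=> [||_ [f Tf <-]].
- exact: frakA_acts_on_coinv.
- by case: (gen_psi R).
have [P pP fE] := Tf; have [n hP] := poly_pdeg pP.
have : gen f by rewrite fE; exact: gen_pdeg (gen_za R) _ _ hP.
(* Classes are sets, so their equality is two inclusions, each obtained by adding or subtracting the
   element f - D psi of the relations. *)
case=> _ [D hD KD]; exists D => //; apply/seteqP; split=> g [Tg Kg]; split=> //.
  by rewrite -(subrK f g) -addrA; exact: lspanD.
rewrite -(subrK (D (@psi11 R)) g) -addrA; apply: lspanD => //.
by rewrite -opprB -scaleN1r; exact: lspanZ.
Qed.
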